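(* Let $X$ be an infinite-dimensional real Banach space, $p\in\{1,2,\dots\}\cup\{\infty\}$, and let $A\subseteq X$ be a $C^p$ smooth bounded starlike body (starlike with respect to the origin). Then there exists a $C^p$ smooth bump function $g:X\to\mathbb{R}$ such that $\operatorname{supp} g=A$ and $g'(x)\neq0$ for every $x\in\operatorname{int}A$.
   Context: A closed set $A\subseteq X$ is a starlike body (with respect to $0$) if $0\in\operatorname{int}A$ and every ray emanating from $0$ meets the boundary $\partial A$ at most once. Its Minkowski functional is $q_A(x)=\inf\{\lambda>0: x/\lambda\in A\}$, and its characteristic cone is $\{x: rx\in A \text{ for all } r>0\}=q_A^{-1}(0)$. $A$ is $C^p$ smooth if $q_A$ is $C^p$ smooth (Fréchet sense) on $X\setminus q_A^{-1}(0)$; for bounded $A$ this means $q_A$ is $C^p$ on $X\setminus\{0\}$. A bump function is a function not identically zero with bounded support, where $\operatorname{supp} g=\overline{\{x: g(x)\neq0\}}$. *)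

(* Defs.v *)
From HB Require Import structures.
From mathcomp Require Import all_boot all_order all_algebra.
From mathcomp Require Import all_classical all_reals all_analysis.
Set Implicit Arguments. Unset Strict Implicit. Unset Printing Implicit Defensive.
Import Order.TTheory GRing.Theory Num.Theory.
Import numFieldNormedType.Exports.
Local Open Scope classical_set_scope.
Local Open Scope ring_scope.

Inductive smooth_order := Fin of nat | Inf.

Definition order_le (k : nat) (p : smooth_order) : Prop :=
  match p with Fin n => (k <= n)%N | Inf => True end.

Section Defs.
Variables (R : realType).

Definition infinite_dimensional (X : normedModType R) : Prop :=
  forall (n : nat) (v : 'I_n -> X), exists x : X,
    forall c : 'I_n -> R, x <> \sum_(i < n) c i *: v i.

Variables (X Y : normedModType R).

Definition ext0 (k : nat) (u : X) (h : 'I_k -> X) : 'I_k.+1 -> X :=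
  fun j => if unlift ord0 j is Some j' then h j' else u.

Definition upd (k : nat) (h : 'I_k -> X) (i : 'I_k) (u : X) : 'I_k -> X :=
  fun j => if j == i then u else h j.

Definition bounded_multilinear (k : nat) (L : ('I_k -> X) -> Y) : Prop :=
  (forall (h : 'I_k -> X) (i : 'I_k) (a : R) (u v : X),
      L (upd h i (a *: u + v)) = a *: L (upd h i u) + L (upd h i v)) /\
  (exists M : R, forall h : 'I_k -> X, `|L h| <= M * \prod_(i < k) `|h i|).

(* G x is the Frechet derivative at x of the map x |-> F x, where F takes
   values in the space of bounded k-linear maps with the operator (sup) norm;
   the space L(X, L^k(X,Y)) is identified with L^(k+1)(X,Y), the new
   direction being the first argument. *)
Definition frechet_deriv_at (k : nat) (F : X -> ('I_k -> X) -> Y)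
    (G : X -> ('I_k.+1 -> X) -> Y) (x : X) : Prop :=
  forall eps : R, 0 < eps -> exists2 delta : R, 0 < delta &
    forall u : X, `|u| < delta -> forall h : 'I_k -> X,
      `|F (x + u) h - F x h - G x (ext0 u h)|
        <= eps * `|u| * \prod_(i < k) `|h i|.

Definition opnorm_continuous_at (k : nat) (F : X -> ('I_k -> X) -> Y)
    (x : X) : Prop :=
  forall eps : R, 0 < eps -> exists2 delta : R, 0 < delta &
    forall y : X, `|y - x| < delta -> forall h : 'I_k -> X,
      `|F y h - F x h| <= eps * \prod_(i < k) `|h i|.

Definition Cp_on (p : smooth_order) (U : set X) (f : X -> Y) : Prop :=
  exists D : forall k : nat, X -> ('I_k -> X) -> Y,
    (forall x (h : 'I_0 -> X), D 0%N x h = f x) /\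
    (forall k x, order_le k p -> U x -> bounded_multilinear (D k x)) /\
    (forall k x, order_le k.+1 p -> U x -> frechet_deriv_at (D k) (D k.+1) x) /\
    (forall k x, order_le k p -> U x -> opnorm_continuous_at (D k) x).
End Defs.

Section Starlike.
Variables (R : realType) (X : normedModType R).

Definition boundary (A : set X) : set X := closure A `\` interior A.

Definition starlike_body (A : set X) : Prop :=
  closed A /\ interior A 0 /\
  forall x : X, x != 0 -> forall r s : R, 0 < r -> 0 < s ->
    boundary A (r *: x) -> boundary A (s *: x) -> r = s.

Definition minkowski (A : set X) (x : X) : R :=
  inf [set l : R | 0 < l /\ A (l^-1 *: x)].

Definition smooth_body (p : smooth_order) (A : set X) : Prop :=
  Cp_on p (~` (minkowski A @^-1` [set 0])) (minkowski A).

Definition fsupp (g : X -> R) : set X := closure [set x | g x != 0].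

Definition bump_function (g : X -> R) : Prop :=
  (exists x, g x != 0) /\ [bounded x | x in fsupp g].
End Starlike.

(* The (Frechet) differential g'(x) in MathComp-Analysis' sense ('d g x). *)
Definition fderiv (R : realType) (X : normedModType R) (g : X -> R) (x : X)
  : X -> R := @diff R X R^o _ (Phantom _ (nbhs x)) g.

(* Main.v *)
Require Import Defs.
From HB Require Import structures.
From mathcomp Require Import all_boot all_order all_algebra.
From mathcomp Require Import all_classical all_reals all_analysis.
From mathcomp Require Import zify ring lra.
Import Order.TTheory GRing.Theory Num.Theory.
Import numFieldNormedType.Exports.
Local Open Scope classical_set_scope.
Local Open Scope ring_scope.
Set Implicit Arguments.
Unset Strict Implicit.
Unset Printing Implicit Defensive.

(** Let q be the gauge of A and theta(t) = exp(-1/t) for t > 0, theta(t) = 0 for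
    t <= 0. Then theta(1 - q) has support A, but q is singular at 0. The point
    0 is pushed "to infinity" along a bounded sequence 0 = e_0, e_1, e_2, ...
    without cluster points: Psi_n is the map x |-> x - b_n(x) (e_{n+1} - e_n),
    with b_n supported in a thin tube around the line through e_n and e_{n+1},
    so that Psi_n^{-1}(e_n) is the point e_{n+1} and Psi_n' is onto. By Riesz's
    lemma the e_n can be chosen so that the tubes are locally finite; hence
    F = q o Psi_0 o Psi_1 o ... is locally a finite composition, smooth with
    F' <> 0 everywhere, and F = q off a small ball. So theta(1 - F) is the
    required bump.

    Smoothness is handled through families of functions F : X -> P -> R that
    are bounded by a weight w on the parameter set P, all estimates being
    uniform with respect to w: the derivative of such a family is again one,
    over X * P with weight |u| w(p). Iterating from P = unit gives the higher
    derivatives with their operator norms. *)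

(** * Families with derivatives uniform in a parameter *)

Section Families.
Context (R : realType) (X : normedModType R).

(** Psi_n displaces points only in the direction v = e_{n+1} - e_n, so all that is asked of it
    concerns b_n along v: if b_n is 1/2-Lipschitz there, both the uniqueness of the preimage of e_n
    and the surjectivity of u - b_n'(u) v follow, and no inverse of Psi_n is ever needed. Across the
    tube b_n may be as steep as one likes, so tubes can be thin. The price is length: a bump of
    height 1 and slope at most 1/2 needs a long tube, and the sequence is scaled down until all
    tubes lie well inside q < 1. Infinite dimension is what keeps these long tubes, for
    non-consecutive indices, at a uniform distance. The only smooth function at hand is q itself,
    and A need not be convex. So q also supplies the cutoffs across the tubes and, through its
    derivative, the functionals measuring position along them, while two-sided bounds by the norm
    stand in for a triangle inequality for q. *)

Definition family_bounded (P : Type) (w : P -> R) (a : P -> R) : Prop :=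
  exists2 M, 0 <= M & forall p, `|a p| <= M * w p.

Definition family_continuous (P : Type) (w : P -> R) (F : X -> P -> R)
    (x : X) : Prop :=
  forall e, 0 < e -> \forall y \near x, forall p, `|F y p - F x p| <= e * w p.

Definition diff_weight (P : Type) (w : P -> R) (up : X * P) : R :=
  `|up.1| * w up.2.

Record is_fderiv (P : Type) (w : P -> R) (F : X -> P -> R) (x : X)
    (L : X * P -> R) : Prop := IsFderiv {
  fderiv_lin : forall p a u v, L (a *: u + v, p) = a * L (u, p) + L (v, p) ;
  fderiv_bounded : family_bounded (diff_weight w) L ;
  fderiv_approx : forall e, 0 < e -> \forall y \near x, forall p,
    `|F y p - F x p - L (y - x, p)| <= e * (`|y - x| * w p) }.

Lemma near_line (Q : X -> Prop) (x u : X) : (\forall y \near x, Q y) ->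
  exists2 t : R, 0 < t & Q (x + t *: u).
Proof.
move/nbhs_normP => [d /= d0 dQ].
have u1 : 0 < `|u| + 1 by rewrite ltr_wpDl.
exists (d / 2 / (`|u| + 1)); first by rewrite !divr_gt0.
apply: dQ; rewrite /= opprD addrA subrr add0r normrN normrZ ger0_norm;
  last first.
  by rewrite ltW // !divr_gt0.
apply: (@le_lt_trans _ _ (d / 2)); last lra.
rewrite -[leLHS]mulrA.
rewrite ler_piMr //; first by rewrite ltW // divr_gt0.
by rewrite mulrC ler_pdivrMr // mul1r lerDl.
Qed.

Lemma near_lipschitz (h : X -> X) (K : R) (x : X) (Q : X -> Prop) :
  (\forall y \near x, `|h y - h x| <= K * `|y - x|) ->
  (\forall z \near h x, Q z) -> \forall y \near x, Q (h y).
Proof.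
move=> hK /nbhs_normP [d /= d0 dQ].
have K1 : 0 < `|K| + 1 by rewrite ltr_wpDl.
have nd : \forall y \near x, `|y - x| < d / (`|K| + 1).
  apply/nbhs_normP; exists (d / (`|K| + 1)) => /=; first exact: divr_gt0.
  by move=> y /=; rewrite distrC.
apply: filterS2 hK nd => y hy dy; apply: dQ => /=.
rewrite distrC; apply: le_lt_trans hy _.
move: dy; rewrite ltr_pdivlMr // => dy; apply: le_lt_trans dy.
rewrite mulrC ler_wpM2l //; apply: le_trans (ler_norm _) _.
by rewrite lerDl.
Qed.

Section PerWeight.
Context (P : Type) (w : P -> R) (w0 : forall p, 0 <= w p).
Implicit Types (F G : X -> P -> R).

Lemma diff_weight_ge0 up : 0 <= diff_weight w up.
Proof. by rewrite /diff_weight mulr_ge0. Qed.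

Lemma fderiv_lin0 F x L p : is_fderiv w F x L -> L (0, p) = 0.
Proof. by case=> /(_ p 1 0 0); rewrite scaler0 addr0 mul1r => ?; lra. Qed.

Lemma fderiv_linZ F x L p a u : is_fderiv w F x L ->
  L (a *: u, p) = a * L (u, p).
Proof.
move=> dF; case: (dF) => /(_ p a u 0).
by rewrite addr0 (fderiv_lin0 p dF) addr0.
Qed.

Lemma fderiv_linB F x L p u v : is_fderiv w F x L ->
  L (u - v, p) = L (u, p) - L (v, p).
Proof.
case=> /(_ p (-1) v u) + _ _.
by rewrite scaleN1r addrC => ->; rewrite mulN1r addrC.
Qed.

Lemma fderiv_unique F x L1 L2 : is_fderiv w F x L1 -> is_fderiv w F x L2 ->
  L1 = L2.
Proof.
move=> d1 d2; apply/funext => -[u p]; apply/eqP; rewrite -subr_eq0 -normr_le0.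
apply/ler_addgt0Pl => e e0; rewrite addr0.
(* The [+ 1] keeps the denominator positive when [u] or the weight vanishes; the same device recurs
   below. *)
have uw1 : 0 < 2 * (`|u| * w p) + 1 by rewrite ltr_wpDl // !mulr_ge0.
have e'0 : 0 < e / (2 * (`|u| * w p) + 1) by rewrite divr_gt0.
set e' := e / _ in e'0.
have n1 := fderiv_approx d1 e'0; have n2 := fderiv_approx d2 e'0.
have [t t0 []] := near_line u (filterI n1 n2).
have xx : x + t *: u - x = t *: u by rewrite addrC addKr.
move=> /(_ p) + /(_ p); rewrite xx.
rewrite (fderiv_linZ _ _ _ d1) (fderiv_linZ _ _ _ d2) => a1 a2.
have : `|t * (L1 (u, p) - L2 (u, p))| <= 2 * (e' * (`|t *: u| * w p)).
  set A := (F _ _ - _) in a1 a2.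
  have -> : t * (L1 (u, p) - L2 (u, p)) =
    (A - t * L2 (u, p)) - (A - t * L1 (u, p)) by ring.
  by apply: le_trans (ler_normB _ _) _; lra.
rewrite normrM normrZ (gtr0_norm t0) => a3.
rewrite -(ler_pM2l t0); apply: le_trans a3 _.
have -> : 2 * (e' * (t * `|u| * w p)) = t * (e' * (2 * (`|u| * w p))) by ring.
by rewrite ler_pM2l // /e' mulrAC ler_pdivrMr // ler_wpM2l ?lerDl // ltW.
Qed.

Lemma fderiv_lipschitz F x L : is_fderiv w F x L ->
  exists2 K, 0 <= K & \forall y \near x, forall p,
    `|F y p - F x p| <= K * (`|y - x| * w p).
Proof.
case=> _ [M M0 bL] /(_ 1 ltr01) nF; exists (M + 1); first by rewrite addr_ge0.
apply: filterS nF => y hy p.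
rewrite -(subrK (L (y - x, p)) (_ - _)); apply: le_trans (ler_normD _ _) _.
rewrite mulrDl addrC lerD //; exact: bL.
Qed.

Lemma near_norm_lt (x : X) (d : R) : 0 < d -> \forall y \near x, `|y - x| < d.
Proof.
by move=> d0; apply/nbhs_normP; exists d => //= y /=; rewrite distrC.
Qed.

Lemma fderiv_continuous F x L : is_fderiv w F x L -> family_continuous w F x.
Proof.
move=> /fderiv_lipschitz[K K0 nK] e e0.
have K1 : 0 < K + 1 by rewrite ltr_wpDl.
have nd := near_norm_lt x (divr_gt0 e0 K1).
apply: filterS2 nK nd => y hy dy p; apply: le_trans (hy p) _.
rewrite mulrA ler_wpM2r //.
move: dy; rewrite ltr_pdivlMr // => /ltW; apply: le_trans.
by rewrite mulrC ler_wpM2l // lerDl.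
Qed.

Lemma family_continuous_near_bounded F x :
  family_bounded w (F x) -> family_continuous w F x ->
  exists2 M, 0 <= M & \forall y \near x, forall p, `|F y p| <= M * w p.
Proof.
move=> [M M0 bM] /(_ 1 ltr01) nF; exists (M + 1); first by rewrite addr_ge0.
apply: filterS nF => y hy p; rewrite -(subrK (F x p) (F y p)).
apply: le_trans (ler_normD _ _) _; rewrite mulrDl addrC lerD //.
Qed.

Lemma eq_is_fderiv F G x L : (\forall y \near x, F y = G y) ->
  is_fderiv w F x L -> is_fderiv w G x L.
Proof.
move=> FG [lL bL aL]; split=> // e e0; have Gx := nbhs_singleton FG.
by apply: filterS2 FG (aL _ e0) => y -> hy p; rewrite -Gx.
Qed.

Lemma eq_family_continuous F G x : (\forall y \near x, F y = G y) ->
  family_continuous w F x -> family_continuous w G x.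
Proof.
move=> FG cF e e0; have Gx := nbhs_singleton FG.
by apply: filterS2 FG (cF _ e0) => y -> hy p; rewrite -Gx.
Qed.

Lemma is_fderiv_cst (c : P -> R) x : is_fderiv w (fun=> c) x (fun=> 0).
Proof.
split; first by move=> *; rewrite mulr0 addr0.
- by exists 0 => // p; rewrite normr0 mul0r.
- move=> e e0; apply: filterE => y p; rewrite !subrr normr0.
  by rewrite !mulr_ge0 // ltW.
Qed.

Lemma is_fderivD F G x L K : is_fderiv w F x L -> is_fderiv w G x K ->
  is_fderiv w (fun y p => F y p + G y p) x (fun up => L up + K up).
Proof.
case=> lL [M M0 bL] aL [lK [N N0 bK] aK]; split.
- by move=> p a u v; rewrite lL lK; ring.
- exists (M + N); first by rewrite addr_ge0.
  by move=> p; apply: le_trans (ler_normD _ _) _; rewrite mulrDl lerD.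
- move=> e e0; have e2 : 0 < e / 2 by rewrite divr_gt0.
  apply: filterS2 (aL _ e2) (aK _ e2) => y h1 h2 p.
  have -> : F y p + G y p - (F x p + G x p) - (L (y - x, p) + K (y - x, p)) =
   (F y p - F x p - L (y - x, p)) + (G y p - G x p - K (y - x, p)) by ring.
  apply: le_trans (ler_normD _ _) _.
  have := h1 p; have := h2 p; lra.
Qed.

(** Every change of parameter set goes through this substitution: freezing a direction, forgetting a
    component, regrouping a tuple. The constant [K] compares the two weights. *)
Lemma is_fderiv_reindex (Q : Type) (v : Q -> R) (s : Q -> P) (K : R) F x L :
  (forall q, 0 <= v q) -> 0 <= K -> (forall q, w (s q) <= K * v q) ->
  is_fderiv w F x L ->
  is_fderiv v (fun y q => F y (s q)) x (fun uq => L (uq.1, s uq.2)).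
Proof.
move=> v0 K0 sK [lL [M M0 bL] aL]; split.
- by move=> q a u u'; rewrite lL.
- exists (M * K); first exact: mulr_ge0.
  move=> -[u q]; apply: le_trans (bL _) _; rewrite -mulrA ler_wpM2l //.
  by rewrite /diff_weight /= mulrCA ler_wpM2l.
- move=> e e0; have K1 : 0 < K + 1 by rewrite ltr_wpDl.
  have e1 : 0 < e / (K + 1) by rewrite divr_gt0.
  apply: filterS (aL _ e1) => y hy q; apply: le_trans (hy _) _.
  rewrite mulrCA [leRHS]mulrCA ler_wpM2l // mulrAC ler_pdivrMr // -mulrA.
  rewrite ler_wpM2l ?(ltW e0) //; apply: le_trans (sK q) _.
  by rewrite mulrC ler_wpM2l // lerDl.
Qed.

End PerWeight.
End Families.

(** * Product and chain rules *)

Section ScalarFunctions.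
Context (R : realType) (X : normedModType R).

Definition unit_weight : unit -> R := fun=> 1.
Definition as_family (f : X -> R) : X -> unit -> R := fun x _ => f x.

Lemma unit_weight_ge0 u : 0 <= unit_weight u.
Proof. exact: ler01. Qed.

Lemma ler_normM (a b A B : R) : `|a| <= A -> `|b| <= B -> `|a * b| <= A * B.
Proof. by move=> ? ?; rewrite normrM ler_pM. Qed.

Lemma is_fderivM (P : Type) (w w' : P -> R) (F G : X -> P -> R) (x : X)
    (L K : X * P -> R) :
  (forall p, 0 <= w p) -> (forall p, 0 <= w' p) ->
  family_bounded w (F x) -> family_bounded w' (G x) ->
  is_fderiv w F x L -> is_fderiv w' G x K ->
  is_fderiv (fun p => w p * w' p) (fun y p => F y p * G y p) x
    (fun up => L up * G x up.2 + F x up.2 * K up).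
Proof.
move=> w0 w'0 [A A0 bF] bG dF dG.
have cG := fderiv_continuous w'0 dG.
have [B B0 nG] := family_continuous_near_bounded bG cG.
have {}bG := nbhs_singleton nG.
case: dF => lL [M M0 bL] aL; case: dG => lK [N N0 bK] aK; split.
- by move=> p a u v /=; rewrite lL lK; ring.
- exists (M * B + A * N); first by rewrite addr_ge0 // mulr_ge0.
  move=> -[u p] /=; apply: le_trans (ler_normD _ _) _.
  have := ler_normM (bL (u, p)) (bG p); have := ler_normM (bF p) (bK (u, p)).
  by rewrite /diff_weight /=; lra.
- move=> e e0; set S := A + B + M + 1.
  have S0 : 0 < S by rewrite /S ltr_wpDl // !addr_ge0.
  have e1 : 0 < e / S by rewrite divr_gt0.
  apply: filterS (filterI (filterI (aL _ e1) (aK _ e1))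
                          (filterI (cG _ e1) nG)) => y [[h1 h2] [h3 h4]] p.
  have -> : F y p * G y p - F x p * G x p -
      (L (y - x, p) * G x p + F x p * K (y - x, p)) =
    (F y p - F x p - L (y - x, p)) * G y p + L (y - x, p) * (G y p - G x p) +
    F x p * (G y p - G x p - K (y - x, p)) by ring.
  have k1 := ler_normM (h1 p) (h4 p).
  have k2 := ler_normM (bL (y - x, p)) (h3 p).
  have k3 := ler_normM (bF p) (h2 p).
  apply: le_trans (ler_normD _ _) _.
  apply: le_trans (lerD (le_trans (ler_normD _ _) (lerD k1 k2)) k3) _.
  rewrite /diff_weight /=.
  set T := `|y - x| * (w p * w' p).
  have T0 : 0 <= T by rewrite /T !mulr_ge0.
  have -> : e / S * (`|y - x| * w p) * (B * w' p) +
    M * (`|y - x| * w p) * (e / S * w' p) +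
    A * w p * (e / S * (`|y - x| * w' p)) = e / S * (S - 1) * T.
    by rewrite /T /S; ring.
  rewrite ler_wpM2r // mulrAC ler_pdivrMr // ler_wpM2l ?(ltW e0) //.
  by rewrite gerBl.
Qed.

Lemma is_derive_approx (phi : R -> R) (s c e : R) :
  is_derive s 1 phi c -> 0 < e ->
  \forall t \near s, `|phi t - phi s - c * (t - s)| <= e * `|t - s|.
Proof.
move=> [dphi dc] e0.
have /cvgrPdist_le /(_ _ e0) : h^-1 *: ((phi \o shift s) (h *: 1) - phi s)
   @[h --> 0^'] --> c by rewrite -dc; exact: dphi.
move=> /nbhs_ballP [d /= d0 hd]; apply/nbhs_normP; exists d => //= t st.
have [->|ts] := eqVneq t s; first by rewrite !subrr mulr0 subrr normr0 mulr0.
have ts0 : t - s != 0 by rewrite subr_eq0.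
have bt : ball 0 d (t - s) by rewrite /ball /= sub0r normrN distrC.
have /= := hd _ bt ts0.
rewrite /shift /= /GRing.scale /= mulr1 subrK => k.
have -> : phi t - phi s - c * (t - s) =
  - (c - (t - s)^-1 * (phi t - phi s)) * (t - s) by field.
by rewrite normrM normrN ler_wpM2r.
Qed.

Lemma is_fderiv_comp_real (f : X -> R) (phi : R -> R) (x : X) (c : R) L :
  is_fderiv unit_weight (as_family f) x L -> is_derive (f x) 1 phi c ->
  is_fderiv unit_weight (as_family (phi \o f)) x (fun up => c * L up).
Proof.
move=> df dphi; have [K K0 nK] := fderiv_lipschitz df.
have cf := fderiv_continuous unit_weight_ge0 df.
case: df => lL [M M0 bL] aL; split.
- by move=> p a u v; rewrite lL; ring.
- exists (`|c| * M); first by rewrite mulr_ge0.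
  by move=> p; rewrite normrM -mulrA ler_wpM2l.
- move=> e e0; set S := K + `|c| + 1.
  have S0 : 0 < S by rewrite /S ltr_wpDl // addr_ge0.
  have e1 : 0 < e / S by rewrite divr_gt0.
  have [d /= d0 hd] := (nbhs_normP _ _).1 (is_derive_approx dphi e1).
  have d2 : 0 < d / 2 by rewrite divr_gt0.
  apply: filterS (filterI (filterI (aL _ e1) nK) (cf _ d2)).
  move=> y [[h1 h2] h3] p; move: (h1 p) (h2 p) (h3 p).
  rewrite /as_family /unit_weight !mulr1 /= => {}h1 {}h2 {}h3.
  have h4 : `|phi (f y) - phi (f x) - c * (f y - f x)| <= e / S * `|f y - f x|.
    by apply: hd => /=; rewrite distrC; apply: le_lt_trans h3 _; lra.
  have -> : phi (f y) - phi (f x) - c * L (y - x, p) =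
    (phi (f y) - phi (f x) - c * (f y - f x)) +
    c * (f y - f x - L (y - x, p)) by ring.
  apply: le_trans (ler_normD _ _) _.
  have h5 := ler_normM (lexx `|c|) h1.
  have h6 : e / S * `|f y - f x| <= e / S * (K * `|y - x|).
    by rewrite ler_wpM2l // ltW.
  apply: le_trans (lerD (le_trans h4 h6) h5) _.
  have -> : e / S * (K * `|y - x|) + `|c| * (e / S * `|y - x|) =
    e / S * (S - 1) * `|y - x| by rewrite /S; ring.
  rewrite ler_wpM2r // mulrAC ler_pdivrMr // ler_wpM2l ?(ltW e0) //.
  by rewrite gerBl.
Qed.

(** Besides the deletion maps this covers translations ([b] constant 1) and projections ([b] a
    functional), so a single chain rule serves for all inner maps. *)
Definition push (b : X -> R) (v : X) (x : X) : X := x - b x *: v.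

Lemma push_lipschitz (b : X -> R) v x B :
  is_fderiv unit_weight (as_family b) x B ->
  exists2 K, 0 <= K &
    \forall y \near x, `|push b v y - push b v x| <= K * `|y - x|.
Proof.
move=> /fderiv_lipschitz[K K0 nK]; exists (1 + K * `|v|).
  by rewrite addr_ge0 // mulr_ge0.
apply: filterS nK => y /(_ tt); rewrite /as_family /unit_weight mulr1 => hy.
have -> : push b v y - push b v x = (y - x) - (b y - b x) *: v.
  by rewrite /push scalerBl !opprD !opprK addrACA.
apply: le_trans (ler_normB _ _) _; rewrite normrZ mulrDl mul1r lerD2l.
by rewrite mulrAC ler_wpM2r.
Qed.

(** The derivative of [push b v] is u - B(u) v, and linearity of [L] splits its value there into the
    scalars L(u) and B(u) L(v). Hence the chain rule needs no vector-valued families. *)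
Lemma is_fderiv_comp_push (P : Type) (w : P -> R) (G : X -> P -> R)
    (b : X -> R) (v x : X) L B :
  (forall p, 0 <= w p) -> is_fderiv w G (push b v x) L ->
  is_fderiv unit_weight (as_family b) x B ->
  is_fderiv w (fun y => G (push b v y)) x
    (fun up => L up - B (up.1, tt) * L (v, up.2)).
Proof.
move=> w0 dG db; have [K K0 nK] := push_lipschitz v db.
have lin2 u c p : L (u - c *: v, p) = L (u, p) - c * L (v, p).
  by rewrite (fderiv_linB _ _ _ dG) (fderiv_linZ _ _ _ dG).
case: (dG) => lL [M M0 bL] aL; case: db => lB [N N0 bB] aB; split.
- by move=> p a u u' /=; rewrite lL lB; ring.
- exists (M + N * M * `|v|); first by rewrite addr_ge0 // !mulr_ge0.
  move=> -[u p] /=; apply: le_trans (ler_normB _ _) _.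
  have := ler_normM (bB (u, tt)) (bL (v, p)); have := bL (u, p).
  by rewrite /diff_weight /unit_weight /=; lra.
- move=> e e0; set S := K + M * `|v| + 1.
  have S0 : 0 < S by rewrite /S ltr_wpDl // addr_ge0 // mulr_ge0.
  have e1 : 0 < e / S by rewrite divr_gt0.
  apply: filterS (filterI (filterI (near_lipschitz nK (aL _ e1)) nK)
    (aB _ e1)) => y [[h1 h2] h3] p.
  move: (h1 p) (h3 tt); rewrite /as_family /unit_weight mulr1 => {}h1 {}h3.
  set z := push b v y in h1 h2 *; set z0 := push b v x in h1 h2 dG *.
  set D := b y - b x - B (y - x, tt) in h3.
  have zE : z - z0 = (y - x) - B (y - x, tt) *: v - D *: v.
    have -> : z - z0 = y - x - (B (y - x, tt) + D) *: v.
      rewrite /D [B _ + _]addrC subrK.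
      by rewrite /z /z0 /push scalerBl !opprD !opprK addrACA.
    by rewrite scalerDl opprD addrA.
  have -> : G z p - G z0 p -
      (L (y - x, p) - B (y - x, tt) * L (v, p)) =
      (G z p - G z0 p - L (z - z0, p)) - D * L (v, p).
    by rewrite zE !lin2; ring.
  apply: le_trans (ler_normB _ _) _.
  apply: le_trans (lerD (le_trans h1 _) (ler_normM h3 (bL (v, p)))) _.
    by apply: ler_wpM2l; [exact: ltW|apply: ler_wpM2r; [exact: w0|exact: h2]].
  rewrite /diff_weight /=.
  have -> : e / S * (K * `|y - x| * w p) +
      e / S * `|y - x| * (M * (`|v| * w p)) =
    e / S * (S - 1) * (`|y - x| * w p) by rewrite /S; ring.
  rewrite ler_wpM2r // ?mulr_ge0 // mulrAC ler_pdivrMr //.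
  by rewrite ler_wpM2l ?(ltW e0) // gerBl.
Qed.

End ScalarFunctions.
Arguments unit_weight {R}.
Arguments unit_weight_ge0 {R}.

(** * Smooth families and functions *)

Section Smoothness.
Context (R : realType) (X : normedModType R).

(** Total by choice, with value 0 where no derivative exists, so that it can be iterated without
    carrying proofs. *)
Definition der (P : Type) (w : P -> R) (F : X -> P -> R) (x : X) :
    X * P -> R :=
  if pselect (exists L, is_fderiv w F x L) is left e then projT1 (cid e)
  else fun=> 0.

Lemma derP (P : Type) (w : P -> R) (F : X -> P -> R) x L :
  is_fderiv w F x L -> is_fderiv w F x (der w F x).
Proof.
rewrite /der; case: pselect => [e _|ne dF]; first by case: (cid e).
by case: ne; exists L.
Qed.

Lemma derE (P : Type) (w : P -> R) (F : X -> P -> R) x L :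
  (forall p, 0 <= w p) -> is_fderiv w F x L -> der w F x = L.
Proof. by move=> w0 dF; apply: (fderiv_unique w0 (derP dF) dF). Qed.

(** Continuity is demanded only of the last derivative; at the earlier levels differentiability
    already gives it. *)
Fixpoint Cn (n : nat) (P : Type) (w : P -> R) (F : X -> P -> R) (U : set X)
    {struct n} : Prop :=
  match n with
  | 0 => forall x, U x -> family_bounded w (F x) /\ family_continuous w F x
  | m.+1 => (forall x, U x ->
                family_bounded w (F x) /\ is_fderiv w F x (der w F x)) /\
            Cn m (diff_weight w) (der w F) U
  end.

Lemma Cn_family_bounded n (P : Type) (w : P -> R) F U x :
  Cn n w F U -> U x -> family_bounded w (F x).
Proof.
case: n => [|n] /=; first by move=> + Ux => /(_ x Ux)[].
by case=> + _ Ux => /(_ x Ux)[].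
Qed.

Lemma Cn_continuous n (P : Type) (w : P -> R) F U x :
  (forall p, 0 <= w p) -> Cn n w F U -> U x -> family_continuous w F x.
Proof.
move=> w0; case: n => [|n] /=; first by move=> + Ux => /(_ x Ux)[].
by case=> + _ Ux => /(_ x Ux)[_]; exact: fderiv_continuous.
Qed.

Lemma Cn_pred n (P : Type) (w : P -> R) F U :
  (forall p, 0 <= w p) -> Cn n.+1 w F U -> Cn n w F U.
Proof.
elim: n => [|n IH] in P w F * => w0.
  move=> cF x Ux; split; first exact: Cn_family_bounded cF Ux.
  exact: (Cn_continuous w0 cF Ux).
move=> [cF cF']; split=> //; apply: IH => //; exact: diff_weight_ge0.
Qed.

Lemma Cn_is_fderiv n (P : Type) (w : P -> R) F U x :
  Cn n.+1 w F U -> U x -> is_fderiv w F x (der w F x).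
Proof. by move=> [h _] /h[]. Qed.

Lemma Cn_eq n (P : Type) (w : P -> R) F G U : (forall p, 0 <= w p) -> open U ->
  (forall x, U x -> F x = G x) -> Cn n w F U -> Cn n w G U.
Proof.
elim: n => [|n IH] in P w F G * => w0 oU FG.
  move=> cF x Ux; have [bF {}cF] := cF x Ux; rewrite -FG //; split=> //.
  apply: eq_family_continuous cF; have := open_nbhs_nbhs (conj oU Ux).
  by apply: filterS => y /FG.
have dE x L : U x -> is_fderiv w F x L -> is_fderiv w G x L.
  move=> Ux; apply: eq_is_fderiv; have := open_nbhs_nbhs (conj oU Ux).
  by apply: filterS => y /FG.
move=> [cF cF']; split=> [x Ux|].
  have [bF dF] := cF x Ux; rewrite -FG //; split=> //; apply: derP.
  exact: dE dF.
apply: IH cF' => //; first exact: diff_weight_ge0.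
by move=> x Ux; apply/esym/derE => //; apply: dE => //; have [] := cF x Ux.
Qed.

(** Lets an explicit derivative [G] replace the chosen [der]; they agree on [U] by uniqueness. *)
Lemma Cn_intro n (P : Type) (w : P -> R) F G U :
  (forall p, 0 <= w p) -> open U ->
  (forall x, U x -> family_bounded w (F x)) ->
  (forall x, U x -> is_fderiv w F x (G x)) ->
  Cn n (diff_weight w) G U -> Cn n.+1 w F U.
Proof.
move=> w0 oU bF dF cG; split=> [x Ux|].
  by split; [exact: bF|exact: derP (dF _ Ux)].
apply: Cn_eq cG => //; first exact: diff_weight_ge0.
by move=> x Ux; apply/esym/derE => //; exact: dF.
Qed.

Lemma Cn_sub n (P : Type) (w : P -> R) F (U V : set X) :
  V `<=` U -> Cn n w F U -> Cn n w F V.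
Proof.
elim: n => [|n IH] in P w F * => VU; first by move=> cF x /VU; exact: cF.
by move=> [cF cF']; split; [move=> x /VU; exact: cF|exact: IH].
Qed.

(** All conditions in [Cn] are pointwise and refer to full neighbourhoods in the space, never to
    limits within [U]; so [V] need not even be open. *)
Lemma Cn_local n (P : Type) (w : P -> R) F (U : set X) :
  (forall x, U x -> exists2 V : set X, V x & Cn n w F V) -> Cn n w F U.
Proof.
elim: n => [|n IH] in P w F * => VF.
  by move=> x Ux; have [V Vx cF] := VF x Ux; exact: cF.
split=> [x Ux|]; first by have [V Vx [cF _]] := VF x Ux; exact: cF.
by apply: IH => x Ux; have [V Vx [_ cF]] := VF x Ux; exists V.
Qed.

Lemma Cn_cst n (P : Type) (w : P -> R) (c : P -> R) U :
  (forall p, 0 <= w p) -> open U -> family_bounded w c ->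
  Cn n w (fun=> c) U.
Proof.
elim: n => [|n IH] in P w c * => w0 oU bc.
  move=> x Ux; split=> // e e0; apply: filterE => y p; rewrite subrr normr0.
  by rewrite mulr_ge0 // ltW.
apply: (@Cn_intro n _ _ _ (fun _ _ => 0)) => //.
  by move=> x _; exact: is_fderiv_cst.
apply: IH => //; first exact: diff_weight_ge0.
by exists 0 => // p; rewrite normr0 mul0r.
Qed.

Lemma Cn_reindex n (P Q : Type) (w : P -> R) (v : Q -> R) (s : Q -> P) K F U :
  (forall p, 0 <= w p) -> (forall q, 0 <= v q) -> open U ->
  0 <= K -> (forall q, w (s q) <= K * v q) ->
  Cn n w F U -> Cn n v (fun x q => F x (s q)) U.
Proof.
elim: n => [|n IH] in P Q w v s F * => w0 v0 oU K0 sK.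
  move=> cF x Ux; have [[M M0 bF] {}cF] := cF x Ux; split.
    exists (M * K); first exact: mulr_ge0.
    by move=> q; apply: le_trans (bF _) _; rewrite -mulrA ler_wpM2l.
  move=> e e0; have K1 : 0 < K + 1 by rewrite ltr_wpDl.
  apply: filterS (cF _ (divr_gt0 e0 K1)) => y hy q; apply: le_trans (hy _) _.
  rewrite mulrAC ler_pdivrMr // -mulrA ler_wpM2l ?(ltW e0) //.
  by apply: le_trans (sK q) _; rewrite mulrC ler_wpM2l // lerDl.
move=> cF; apply: Cn_intro => //.
- move=> x Ux; have [M M0 bF] := Cn_family_bounded cF Ux.
  exists (M * K); first exact: mulr_ge0.
  by move=> q; apply: le_trans (bF _) _; rewrite -mulrA ler_wpM2l.
- move=> x Ux; apply: (is_fderiv_reindex v0 K0 sK).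
  exact: Cn_is_fderiv cF Ux.
- case: cF => _ cF'.
  apply: (IH _ _ (diff_weight w) (diff_weight v) (fun uq => (uq.1, s uq.2)));
    rewrite // /diff_weight /=; try by move=> p; rewrite mulr_ge0.
  by move=> q; rewrite mulrCA ler_wpM2l.
Qed.

Lemma Cn_reweight n (P : Type) (w v : P -> R) F U :
  (forall p, w p = v p) -> Cn n w F U -> Cn n v F U.
Proof. by move=> /funext ->. Qed.

Lemma CnD n (P : Type) (w : P -> R) F G U : (forall p, 0 <= w p) -> open U ->
  Cn n w F U -> Cn n w G U -> Cn n w (fun x p => F x p + G x p) U.
Proof.
have bD (Q : Type) (v : Q -> R) a b : family_bounded v a ->
    family_bounded v b -> family_bounded v (fun p => a p + b p).
  move=> [M M0 ba] [N N0 bb]; exists (M + N); first exact: addr_ge0.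
  by move=> p; rewrite mulrDl; apply: le_trans (ler_normD _ _) (lerD _ _).
elim: n => [|n IH] in P w F G * => w0 oU.
  move=> cF cG x Ux; have [bF {}cF] := cF x Ux; have [bG {}cG] := cG x Ux.
  split; first exact: bD.
  move=> e e0; have e2 : 0 < e / 2 by rewrite divr_gt0.
  apply: filterS2 (cF _ e2) (cG _ e2) => y h1 h2 p; rewrite opprD addrACA.
  apply: le_trans (ler_normD _ _) _; have := h1 p; have := h2 p; lra.
move=> cF cG; apply: Cn_intro => //.
- by move=> x Ux; apply: bD; [exact: Cn_family_bounded cF Ux|
    exact: Cn_family_bounded cG Ux].
- by move=> x Ux; apply: is_fderivD; [exact: Cn_is_fderiv cF Ux|
    exact: Cn_is_fderiv cG Ux].
- by apply: IH cF.2 cG.2 => //; exact: diff_weight_ge0.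
Qed.

Lemma CnM n (P : Type) (w w' : P -> R) F G U :
  (forall p, 0 <= w p) -> (forall p, 0 <= w' p) -> open U ->
  Cn n w F U -> Cn n w' G U ->
  Cn n (fun p => w p * w' p) (fun x p => F x p * G x p) U.
Proof.
have bM (Q : Type) (v v' : Q -> R) a b : family_bounded v a ->
    family_bounded v' b ->
    family_bounded (fun p => v p * v' p) (fun p => a p * b p).
  move=> [M M0 ba] [N N0 bb]; exists (M * N); first exact: mulr_ge0.
  by move=> p; rewrite mulrACA; apply: ler_normM.
elim: n => [|n IH] in P w w' F G * => w0 w'0 oU.
  move=> cF cG x Ux; have [bF {}cF] := cF x Ux; have [bG {}cG] := cG x Ux.
  split; first exact: bM.
  move=> e e0; have [B B0 nG] := family_continuous_near_bounded bG cG.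
  case: bF => A A0 bF; set S := A + B + 1.
  have S0 : 0 < S by rewrite /S ltr_wpDl // addr_ge0.
  have e1 : 0 < e / S by rewrite divr_gt0.
  apply: filterS (filterI (filterI (cF _ e1) (cG _ e1)) nG).
  move=> y [[h1 h2] h3] p.
  have -> : F y p * G y p - F x p * G x p =
    (F y p - F x p) * G y p + F x p * (G y p - G x p) by ring.
  apply: le_trans (ler_normD _ _) _.
  apply: le_trans (lerD (ler_normM (h1 p) (h3 p)) (ler_normM (bF p) (h2 p))) _.
  have -> : e / S * w p * (B * w' p) + A * w p * (e / S * w' p) =
    e / S * (S - 1) * (w p * w' p) by rewrite /S; ring.
  rewrite ler_wpM2r // ?mulr_ge0 // mulrAC ler_pdivrMr //.
  by rewrite ler_wpM2l ?(ltW e0) // gerBl.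
move=> cF cG; have cF0 := Cn_pred w0 cF; have cG0 := Cn_pred w'0 cG.
apply: (@Cn_intro n _ _ _
    (fun x up => der w F x up * G x up.2 + F x up.2 * der w' G x up)) => //.
- by move=> p; rewrite mulr_ge0.
- by move=> x Ux; apply: bM; [exact: Cn_family_bounded cF Ux|
    exact: Cn_family_bounded cG Ux].
- move=> x Ux; apply: is_fderivM => //.
  + exact: Cn_family_bounded cF Ux.
  + exact: Cn_family_bounded cG Ux.
  + exact: Cn_is_fderiv cF Ux.
  + exact: Cn_is_fderiv cG Ux.
(* The factor left undifferentiated is viewed as a family over [X * P] that ignores the direction,
   so that the induction hypothesis multiplies families over one parameter set. *)
- have pull (v : P -> R) H : (forall p, 0 <= v p) -> Cn n v H U ->
      Cn n (fun up : X * P => v up.2) (fun x up => H x up.2) U.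
    by move=> v0; apply: (@Cn_reindex _ _ _ _ _ snd 1) => // q; rewrite mul1r.
  apply: CnD => //; first by move=> p; rewrite /diff_weight !mulr_ge0.
  + apply: Cn_reweight (IH _ _ _ _ _ _ _ oU cF.2 (pull _ _ w'0 cG0)).
    * by move=> p; rewrite /diff_weight mulrA.
    * exact: diff_weight_ge0.
    * by [].
  + apply: Cn_reweight (IH _ _ _ _ _ _ _ oU (pull _ _ w0 cF0) cG.2).
    * by move=> p; rewrite /diff_weight mulrCA.
    * by [].
    * exact: diff_weight_ge0.
Qed.
End Smoothness.

(** * Smooth scalar functions and their compositions *)

Section ScalarSmoothness.
Context (R : realType) (X : normedModType R).
Implicit Types (f g b : X -> R) (U V : set X).

Definition Cnf n f U := Cn n unit_weight (as_family f) U.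

Lemma Cnf_is_fderiv f U x : Cnf 1 f U -> U x ->
  is_fderiv unit_weight (as_family f) x (der unit_weight (as_family f) x).
Proof. by case=> h _ /h[]. Qed.

Lemma Cnf_sub n f U V : V `<=` U -> Cnf n f U -> Cnf n f V.
Proof. exact: Cn_sub. Qed.

Lemma CnfD n f g U : open U -> Cnf n f U -> Cnf n g U ->
  Cnf n (fun x => f x + g x) U.
Proof. by move=> oU; apply: CnD oU; exact: unit_weight_ge0. Qed.

Lemma CnfM n f g U : open U -> Cnf n f U -> Cnf n g U ->
  Cnf n (fun x => f x * g x) U.
Proof.
move=> oU cf cg.
have := CnM unit_weight_ge0 unit_weight_ge0 oU cf cg.
by apply: Cn_reweight => p; rewrite /unit_weight mulr1.
Qed.

Lemma Cnf_cst n (c : R) U : open U -> Cnf n (fun=> c) U.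
Proof.
move=> oU; apply: Cn_cst => //.
by exists `|c| => // p; rewrite /unit_weight mulr1.
Qed.

Lemma Cnf_linear n f U : open U ->
  (forall a u v, f (a *: u + v) = a * f u + f v) ->
  (exists2 M, 0 <= M & forall u, `|f u| <= M * `|u|) -> Cnf n f U.
Proof.
move=> oU lf [M M0 bf].
have bx x : family_bounded unit_weight (as_family f x).
  by exists `|f x| => // p; rewrite /unit_weight mulr1.
have fB u v : f (u - v) = f u - f v.
  by rewrite addrC -scaleN1r lf mulN1r addrC.
have w0 := @unit_weight_ge0 R.
have bL : family_bounded (diff_weight unit_weight)
    (fun up : X * unit => f up.1).
  by exists M => // p; rewrite /diff_weight /unit_weight mulr1.
case: n => [|n].
  move=> x Ux; split=> // e e0; have M1 : 0 < M + 1 by rewrite ltr_wpDl.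
  apply: filterS (near_norm_lt x (divr_gt0 e0 M1)) => y.
  rewrite ltr_pdivlMr // /as_family /unit_weight => /ltW hy p.
  rewrite -fB mulr1; apply: le_trans (bf _) _; apply: le_trans hy.
  by rewrite mulrC ler_wpM2l // lerDl.
apply: (@Cn_intro _ _ n _ _ _ (fun _ up => f up.1)) => //.
- move=> x _; split=> // e e0.
  apply: filterE => y p; rewrite /as_family fB subrr normr0.
  by rewrite !mulr_ge0 // ltW.
- by apply: Cn_cst => //; exact: diff_weight_ge0.
Qed.

(** The last derivative need not be continuous, which is why [Cnf_comp_real] asks for order n + 1 to
    obtain a result of order n. *)
Fixpoint smooth_real (n : nat) (phi : R -> R) : Prop :=
  match n with
  | 0 => True
  | m.+1 => exists2 psi : R -> R, (forall s : R, is_derive s 1 phi (psi s)) &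
              smooth_real m psi
  end.

Lemma Cnf_comp_real n (phi : R -> R) f U : open U ->
  smooth_real n.+1 phi -> Cnf n f U -> Cnf n (phi \o f) U.
Proof.
have w0 := @unit_weight_ge0 R.
have bx h x : family_bounded unit_weight (as_family h x : unit -> R).
  by exists `|h x| => // p; rewrite /unit_weight mulr1.
move=> oU; elim: n phi => [|n IH] phi [psi dphi spsi] cf.
  move=> x Ux; split; first exact: bx.
  have [_ cfx] := cf x Ux => e e0.
  set K := `|psi (f x)| + 1; have K0 : 0 < K by rewrite /K ltr_wpDl.
  have [d /= d0 hd] := (nbhs_normP _ _).1 (is_derive_approx (dphi (f x)) ltr01).
  have d1 : 0 < Num.min (d / 2) (e / K).
    by rewrite lt_min !divr_gt0.
  apply: filterS (cfx _ d1) => y /(_ tt).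
  rewrite /as_family /unit_weight mulr1 le_min => /andP[y1 y2] p.
  have y3 : `|f x - f y| < d by rewrite distrC; apply: le_lt_trans y1 _; lra.
  have /= := hd _ y3; rewrite mul1r => h1; rewrite mulr1.
  rewrite -(subrK (psi (f x) * (f y - f x)) (phi (f y) - phi (f x))).
  apply: le_trans (ler_normD _ _) _.
  apply: le_trans (lerD h1 (lexx _)) _; rewrite normrM.
  rewrite -[X in X + _]mul1r -mulrDl addrC -/K.
  by move: y2; rewrite ler_pdivlMr // mulrC.
apply: (@Cn_intro _ _ _ _ _ _ (fun x up => as_family (psi \o f) x up.2 *
     der unit_weight (as_family f) x up)) => //.
- by move=> x Ux; apply: is_fderiv_comp_real (dphi _); exact: (Cn_is_fderiv cf).
- have c1 : Cn n (fun=> 1)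
      (fun x (up : X * unit) => as_family (psi \o f) x up.2) U.
    apply: (Cn_reindex (s := snd) (K := 1) w0)
      (IH _ spsi (Cn_pred w0 cf)) => //.
    by move=> q; rewrite mul1r.
  have ? : forall p : X * unit, (0 : R) <= 1 by [].
  apply: Cn_reweight (CnM _ _ oU c1 cf.2) => //.
  + by move=> p; rewrite mul1r.
  + exact: diff_weight_ge0.
Qed.

Lemma near_push b (v x : X) (Q : X -> Prop) :
  family_continuous unit_weight (as_family b) x ->
  (\forall z \near push b v x, Q z) -> \forall y \near x, Q (push b v y).
Proof.
move=> cb /nbhs_normP [d /= d0 dQ].
have v1 : 0 < `|v| + 1 by rewrite ltr_wpDl.
have d2 : 0 < d / 2 by rewrite divr_gt0.
apply: filterS2 (near_norm_lt x d2) (cb _ (divr_gt0 d2 v1)).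
move=> y h1 /(_ tt); rewrite /as_family /unit_weight mulr1 => h2.
apply: dQ => /=; rewrite distrC.
have -> : push b v y - push b v x = (y - x) - (b y - b x) *: v.
  by rewrite /push scalerBl !opprD !opprK addrACA.
apply: le_lt_trans (ler_normB _ _) _; rewrite normrZ.
have : `|b y - b x| * `|v| <= d / 2.
  apply: le_trans (ler_wpM2r (normr_ge0 v) h2) _.
  by rewrite mulrAC ler_pdivrMr // ler_wpM2l ?(ltW d2) // lerDl.
lra.
Qed.

(** The induction closes because the derivative is built from the same kind of composite: [der w G]
    after the push, once in the free direction and once with the direction frozen at [v], the latter
    at the cost of a factor [|v|] in the weight. *)
Lemma Cn_push n (P : Type) (w : P -> R) (G : X -> P -> R) b (v : X) U V :
  (forall p, 0 <= w p) -> open U -> (forall x, U x -> V (push b v x)) ->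
  Cnf n b U -> Cn n w G V -> Cn n w (fun x => G (push b v x)) U.
Proof.
have u0 := @unit_weight_ge0 R.
elim: n => [|n IH] in P w G * => w0 oU UV cb cG.
  move=> x Ux; have [bG {}cG] := cG _ (UV _ Ux); split=> // e e0.
  exact: near_push (cb x Ux).2 (cG _ e0).
have cb0 := Cn_pred u0 cb.
(* The minus sign is written as a constant factor -1, so that closure under sums and products
   suffices. *)
apply: (@Cn_intro _ _ _ _ _ _ (fun x up => der w G (push b v x) up +
   as_family (fun=> -1) x tt * (der unit_weight (as_family b) x (up.1, tt) *
     der w G (push b v x) (v, up.2)))) => //.
- by move=> x /UV Vx; exact: (Cn_family_bounded cG Vx).
- move=> x Ux.
  have := is_fderiv_comp_push w0 (Cn_is_fderiv cG (UV _ Ux))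
    (Cn_is_fderiv cb Ux).
  by congr is_fderiv; apply/funext => up; rewrite /as_family mulN1r.
- have dw0 (up : X * P) : 0 <= diff_weight w up by exact: diff_weight_ge0.
  have c1 := IH _ _ _ dw0 oU UV cb0 cG.2.
  apply: CnD => //.
  have c2 : Cn n (fun up : X * P => `|up.1|)
      (fun x up => der unit_weight (as_family b) x (up.1, tt)) U.
    apply: (Cn_reindex (s := fun up : X * P => (up.1, tt)) (K := 1)
      _ _ oU _ _ cb.2) => //.
    + exact: diff_weight_ge0.
    + by move=> q; rewrite /diff_weight /unit_weight mul1r mulr1.
  have c3 : Cn n (fun up : X * P => w up.2)
      (fun x up => der w G (push b v x) (v, up.2)) U.
    by apply: (Cn_reindex (s := fun up : X * P => (v, up.2)) (K := `|v|)
      _ _ oU _ _ c1).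
  have c4 : Cn n (fun up : X * P => 1)
      (fun x up => as_family (fun=> -1) x tt) U.
    apply: (@Cn_cst _ _ n _ (fun=> 1) (fun=> -1)) => //.
    by exists 1 => // p; rewrite normrN normr1 mulr1.
  have c5 := CnM (fun=> normr_ge0 _) (fun up : X * P => w0 up.2) oU c2 c3.
  have c6 := CnM _ _ oU c4 c5; apply: Cn_reweight (c6 _ _) => //.
  by move=> p; rewrite mul1r.
Qed.

Lemma Cnf_push n f b (v : X) U V :
  open U -> (forall x, U x -> V (push b v x)) ->
  Cnf n b U -> Cnf n f V -> Cnf n (fun x => f (push b v x)) U.
Proof.
move=> oU UV cb cf; apply: (Cn_push _ oU UV cb cf); exact: unit_weight_ge0.
Qed.

End ScalarSmoothness.

(** * Comparison with towers of multilinear derivatives *)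

Section FrechetTowers.
Context (R : realType) (X : normedModType R).
Implicit Types (f g : X -> R) (U : set X).

Definition prod_weight (k : nat) (h : 'I_k -> X) : R := \prod_(i < k) `|h i|.

Lemma prod_weight_ge0 k (h : 'I_k -> X) : 0 <= prod_weight h.
Proof. by apply: prodr_ge0. Qed.

Lemma ext0_ord0 k u (h : 'I_k -> X) : ext0 u h ord0 = u.
Proof. by rewrite /ext0 unlift_none. Qed.

Lemma ext0_lift k u (h : 'I_k -> X) j : ext0 u h (lift ord0 j) = h j.
Proof. by rewrite /ext0 liftK. Qed.

Lemma upd_ext0 k u v (h : 'I_k -> X) : upd (ext0 u h) ord0 v = ext0 v h.
Proof.
apply/funext => i; rewrite /upd; case: (unliftP ord0 i) => [j|] ->.
  by rewrite eq_sym (negbTE (neq_lift _ _)) !ext0_lift.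
by rewrite eqxx ext0_ord0.
Qed.

Lemma prod_weight_ext0 k u (h : 'I_k -> X) :
  prod_weight (ext0 u h) = `|u| * prod_weight h.
Proof.
rewrite /prod_weight big_ord_recl ext0_ord0; congr (_ * _).
by apply: eq_bigr => i _; rewrite ext0_lift.
Qed.

Lemma prod_weight_recl k (h : 'I_k.+1 -> X) :
  prod_weight h = `|h ord0| * prod_weight (fun j => h (lift ord0 j)).
Proof. by rewrite /prod_weight big_ord_recl. Qed.

Lemma order_le_leq m n p : (m <= n)%N -> order_le n p -> order_le m p.
Proof. by case: p => //= k mn /(leq_trans mn). Qed.

(** Induction on the number [m] of derivatives still to be taken, for all levels [k] of the given
    tower at once; [ext0] translates a pair (direction, tuple) into a longer tuple, and the weights
    correspond exactly. *)
Lemma Cp_on_Cnf p U f n : open U -> Cp_on p U f -> order_le n p -> Cnf n f U.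
Proof.
move=> oU [D [D0 [Dlin [Dder Dcont]]]] np.
have bD k x : order_le k p -> U x -> family_bounded (@prod_weight k) (D k x).
  move=> kp Ux; have [_ [M bM]] := Dlin k x kp Ux; exists `|M| => // h.
  by apply: le_trans (bM h) _; rewrite ler_wpM2r ?prod_weight_ge0 // ler_norm.
have CD m k : order_le (k + m) p -> Cn m (@prod_weight k) (D k) U.
  elim: m k => [|m IH] k kmp.
    rewrite addn0 in kmp => x Ux; split; first exact: bD.
    move=> e e0; have [d d0 hd] := Dcont k x kmp Ux e e0.
    by apply: filterS (near_norm_lt x d0) => y /hd.
  have kp : order_le k p by apply: order_le_leq kmp; rewrite leq_addr.
  have k1p : order_le k.+1 p.
    by apply: order_le_leq kmp; rewrite -addn1 leq_add2l.
  apply: (@Cn_intro _ _ _ _ _ _ (fun x up => D k.+1 x (ext0 up.1 up.2))) => //.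
  - exact: prod_weight_ge0.
  - by move=> x; exact: bD.
  - move=> x Ux; split.
    + move=> h a u v /=; have [+ _] := Dlin k.+1 x k1p Ux.
      by move=> /(_ (ext0 0 h) ord0 a u v); rewrite !upd_ext0.
    + have [M M0 bM] := bD k.+1 x k1p Ux; exists M => // -[u h].
      by apply: le_trans (bM _) _; rewrite prod_weight_ext0.
    + move=> e e0; have [d d0 hd] := Dder k x k1p Ux e e0.
      apply: filterS (near_norm_lt x d0) => y /hd + h => /(_ h).
      by rewrite subrKC mulrA.
  - apply: (Cn_reindex (s := fun up => ext0 up.1 up.2) (K := 1) _ _ oU _ _
      (IH k.+1 _)) => //.
    + exact: prod_weight_ge0.
    + by apply: diff_weight_ge0; exact: prod_weight_ge0.
    + by move=> [u h]; rewrite prod_weight_ext0 mul1r.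
    + by rewrite addSnnS.
have c0 := CD n 0%N np; rewrite /Cnf.
have -> : as_family f = fun x (_ : unit) => D 0%N x (fun=> 0).
  by apply/funext => x; apply/funext => q; rewrite D0.
apply: (Cn_reindex (s := fun=> (fun=> 0)) (K := 1) _ _ oU _ _ c0) => //.
- exact: prod_weight_ge0.
- by move=> q; rewrite /prod_weight big_ord0 /unit_weight mul1r.
Qed.

Lemma is_fderivZ (P : Type) (w : P -> R) (F : X -> P -> R) x L a :
  is_fderiv w F x L ->
  is_fderiv w (fun y p => a * F y p) x (fun up => a * L up).
Proof.
case=> lL [M M0 bL] aL; split.
- by move=> p c u v; rewrite lL; ring.
- exists (`|a| * M); first exact: mulr_ge0.
  by move=> p; rewrite normrM -mulrA ler_wpM2l.
- move=> e e0; have a1 : 0 < `|a| + 1 by rewrite ltr_wpDl.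
  apply: filterS (aL _ (divr_gt0 e0 a1)) => y hy p.
  have -> : a * F y p - a * F x p - a * L (y - x, p) =
    a * (F y p - F x p - L (y - x, p)) by ring.
  rewrite normrM; apply: le_trans (ler_wpM2l (normr_ge0 a) (hy p)) _.
  have W0 := le_trans (normr_ge0 _) (hy p).
  have -> : e * (`|y - x| * w p) =
      (`|a| + 1) * (e / (`|a| + 1) * (`|y - x| * w p)).
    by field; rewrite gt_eqF.
  by rewrite ler_wpM2r // lerDl.
Qed.

(** A linear relation between three parameters passes to the derivative by uniqueness. The three
    slices become families over [unit], under a common weight that dominates each of theirs. *)
Lemma fderiv_param_lin (P : Type) (w : P -> R) (F : X -> P -> R) x L
    (p q r : P) a : (forall p, 0 <= w p) -> is_fderiv w F x L ->
  (forall y, F y p = a * F y q + F y r) ->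
  forall u, L (u, p) = a * L (u, q) + L (u, r).
Proof.
move=> w0 dF FE u; pose v (_ : unit) := w p + w q + w r.
have v0 i : 0 <= v i by rewrite /v !addr_ge0.
have dr s : w s <= v tt -> is_fderiv v (fun y (_ : unit) => F y s) x
    (fun uq => L (uq.1, s)).
  move=> ws; apply: (is_fderiv_reindex (s := fun=> s) (K := 1) v0 _ _ dF) => //.
  by move=> []; rewrite mul1r.
have dp : is_fderiv v (fun y (_ : unit) => F y p) x (fun uq => L (uq.1, p)).
  by apply: dr; have := w0 q; have := w0 r; rewrite /v; lra.
have dq : is_fderiv v (fun y (_ : unit) => F y q) x (fun uq => L (uq.1, q)).
  by apply: dr; have := w0 p; have := w0 r; rewrite /v; lra.
have drr : is_fderiv v (fun y (_ : unit) => F y r) x (fun uq => L (uq.1, r)).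
  by apply: dr; have := w0 q; have := w0 p; rewrite /v; lra.
have := is_fderivD (is_fderivZ a dq) drr.
have <- : (fun y (_ : unit) => F y p) = (fun y _ => a * F y q + F y r).
  by apply/funext => y; apply/funext => _.
move=> /(fderiv_unique v0 dp)/(congr1 (fun H => H (u, tt))); exact.
Qed.

(** Parameters are regrouped into tuples at each level, before the next derivative is taken. As
    [der] does not depend on an order of smoothness, one tower serves all finite orders when [p] is
    [Inf]. *)
Fixpoint tower (g : X -> R) (k : nat) : X -> ('I_k -> X) -> R :=
  match k with
  | 0 => fun x _ => g x
  | m.+1 => fun x h => der (@prod_weight m) (@tower g m) x
                         (h ord0, fun j => h (lift ord0 j))
  end.

Lemma Cnf_Cp_on p g : (forall n, order_le n p -> Cnf n g setT) ->
  Cp_on p setT g.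
Proof.
move=> cg; have oT : open [set: X] by exact: openT.
have CT k n : order_le (k + n) p -> Cn n (@prod_weight k) (tower g (k:=k)) setT.
  elim: k n => [|k IH] n knp.
    apply: (Cn_reindex (s := fun=> tt) (K := 1) _ _ oT _ _ (cg n knp)) => //.
    + exact: prod_weight_ge0.
    + by move=> q; rewrite /prod_weight big_ord0 /unit_weight mul1r.
  have [_ c1] : Cn n.+1 (@prod_weight k) (tower g (k:=k)) setT.
    by apply: IH; rewrite addnS.
  apply: (Cn_reindex (s := fun h : 'I_k.+1 -> X =>
    (h ord0, fun j => h (lift ord0 j))) (K := 1) _ _ oT _ _ c1) => //.
  + by apply: diff_weight_ge0; exact: prod_weight_ge0.
  + exact: prod_weight_ge0.
  + by move=> h; rewrite prod_weight_recl mul1r.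
have dT k x : order_le k.+1 p -> is_fderiv (@prod_weight k) (tower g (k:=k)) x
    (der (@prod_weight k) (tower g (k:=k)) x).
  by move=> kp; apply: (Cn_is_fderiv (CT k 1%N _)); rewrite ?addn1.
(* [Cn] does not record multilinearity. In the newest argument it is part of [is_fderiv]; in the
   older ones it is inherited from the previous level. *)
have lT k x : order_le k p -> forall (h : 'I_k -> X) i a u v,
    tower g x (upd h i (a *: u + v)) =
    a * tower g x (upd h i u) + tower g x (upd h i v).
  elim: k x => [|k IH] x kp h i a u v; first by case: i.
  have kp' : order_le k p by exact: order_le_leq kp.
  have dk := dT k x kp; case: (unliftP ord0 i) => [j|] -> /=.
    have e1 w : upd h (lift ord0 j) w ord0 = h ord0 by rewrite /upd.
    have e2 w : (fun j' => upd h (lift ord0 j) w (lift ord0 j')) =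
        upd (fun j' => h (lift ord0 j')) j w.
      by apply/funext => j'; rewrite /upd (inj_eq lift_inj).
    rewrite !e1 !e2; apply: (fderiv_param_lin _ dk).
      exact: prod_weight_ge0.
    by move=> y; exact: IH.
  have e1 w : upd h ord0 w ord0 = w by rewrite /upd eqxx.
  have e2 w : (fun j' => upd h ord0 w (lift ord0 j')) =
      (fun j' => h (lift ord0 j')).
    by apply/funext => j'; rewrite /upd eq_sym -(negbK (_ == _)) neq_lift.
  by rewrite !e1 !e2 (fderiv_lin dk).
exists (fun k => tower g (k:=k)); split; [by []|split; [|split]].
- move=> k x kp _; split; first by move=> *; rewrite lT.
  have [|M _ bM] := Cn_family_bounded (CT k 0%N _) (I : setT x).
    by rewrite addn0.
  by exists M.
- move=> k x kp _ e e0.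
  have [d /= d0 hd] := (nbhs_normP _ _).1 (fderiv_approx (dT k x kp) e0).
  exists d => // u ud h; have /= := hd (x + u).
  rewrite opprD addNKr normrN => /(_ ud h).
  have -> : x + u - x = u by rewrite addrC addKr.
  rewrite ext0_ord0 mulrA.
  suff -> : (fun j => ext0 u h (lift ord0 j)) = h by [].
  by apply/funext => j; rewrite ext0_lift.
- move=> k x kp _ e e0.
  have [|_ /(_ e e0)/nbhs_normP[d /= d0 hd]] := CT k 0%N _ x I.
    by rewrite addn0.
  by exists d => // y yd h; apply: hd; rewrite /= distrC.
Qed.

Lemma fderivE g x L : is_fderiv unit_weight (as_family g) x L ->
  forall u, fderiv g x u = L (u, tt).
Proof.
move=> dg u; case: (dg) => lL [M M0 bL] aL.
pose df (v : X) : R^o := L (v, tt).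
have ldf : linear df by move=> a v v'; rewrite /df lL.
pose lin := GRing.isLinear.Build R X R^o _ df ldf.
pose Ldf : {linear X -> R^o} := HB.pack df lin.
rewrite /fderiv (@diff_unique R X R^o g Ldf x) //.
  apply/linear_bounded_continuous/linear_boundedP; near=> r => v.
  apply: le_trans (bL (v, tt)) _; rewrite /diff_weight /unit_weight mulr1.
  by rewrite ler_wpM2r //; near: r; apply: nbhs_pinfty_ge; exact: num_real.
apply/eqaddoP => e e0.
have := aL e e0; rewrite (near_shift 0 x) subr0.
apply: filterS => v /(_ tt).
by rewrite /= /as_family /unit_weight mulr1 /shift /= addrK opprD addrA.
Unshelve. all: by end_near.
Qed.
End FrechetTowers.

(** * The flat function exp(-1/t) *)

Section FlatFunction.
Context (R : realType).
Implicit Types (s t : R) (phi psi : R -> R).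

Lemma is_derive_of_approx phi s c :
  (forall e, 0 < e ->
    \forall t \near s, `|phi t - phi s - c * (t - s)| <= e * `|t - s|) ->
  is_derive s 1 phi c.
Proof.
move=> h; have l : h^-1 *: ((phi \o shift s) (h *: (1 : R)) - phi s)
    @[h --> 0^'] --> c.
  apply/cvgrPdist_le => e e0.
  have [d /= d0 hd] := (nbhs_normP _ _).1 (h e e0).
  apply/nbhs_ballP; exists d => //= u; rewrite /ball /= sub0r normrN => ud u0.
  have /= := hd (u + s); rewrite opprD addrCA subrr addr0 normrN => /(_ ud).
  rewrite addrK => k; rewrite /GRing.scale /= mulr1.
  rewrite -(ler_pM2r (_ : 0 < `|u|)) ?normr_gt0 //; apply: le_trans k.
  rewrite -normrM -normrN le_eqVlt; apply/orP; left; apply/eqP.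
  by congr (`| _ |); field.
split; first by apply/cvg_ex; exists c.
exact/cvg_lim.
Qed.

(** [flat 0] is theta. The powers t^-m make the family closed under differentiation, up to linear
    combinations. *)
Definition flat (m : nat) t : R :=
  if 0 < t then t^-1 ^+ m * expR (- t^-1) else 0.

Lemma flat_ge0 m t : 0 <= flat m t.
Proof.
rewrite /flat; case: ifP => // t0.
by rewrite mulr_ge0 ?expR_ge0 // exprn_ge0 // invr_ge0 ltW.
Qed.

Lemma flat_gt0 m t : 0 < t -> 0 < flat m t.
Proof.
by move=> t0; rewrite /flat t0 mulr_gt0 ?expR_gt0 // exprn_gt0 // invr_gt0.
Qed.

Lemma flat_le0 m t : t <= 0 -> flat m t = 0.
Proof. by rewrite /flat leNgt => /negbTE ->. Qed.

(** A single term of the exponential series at y = 1/t, namely y^(m+1)/(m+1)! <= e^y, beats the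
    power t^-m with a factor t to spare. *)
Lemma flat_le m t : 0 <= t -> flat m t <= (m.+1)`!%:R * t.
Proof.
rewrite le_eqVlt => /predU1P[<-|t0]; first by rewrite flat_le0 // mulr0.
have t1 : 0 < t^-1 by rewrite invr_gt0.
rewrite /flat t0 -[X in _ <= _ * X]invrK; move: (t^-1) t1 => y y0.
have f0 : 0 < (m.+1)`!%:R :> R by rewrite ltr0n fact_gt0.
have : y ^+ m.+1 / (m.+1)`!%:R <= expR y.
  by apply: le_trans (expR_ge1Dxn m (ltW y0)); rewrite lerDr.
rewrite ler_pdivrMr // => h.
rewrite expRN ler_pdivrMr ?expR_gt0 // mulrAC ler_pdivlMr //.
by rewrite -exprSr mulrC.
Qed.

Lemma flat_deriv m t :
  is_derive t 1 (flat m) (- m%:R * flat m.+1 t + flat m.+2 t).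
Proof.
case: (ltrgtP t 0) => t0.
- rewrite !flat_le0 ?ltW // mulr0 addr0.
  apply: (@near_eq_is_derive _ _ _ (cst 0)).
  by apply: filterS (lt_nbhsl t0) => y y0; rewrite flat_le0 // ltW.
- have tn : t != 0 by rewrite gt_eqF.
  apply: (@near_eq_is_derive _ _ _ (fun y : R => y^-1 ^+ m * expR (- y^-1))).
    by apply: filterS (lt_nbhsr t0) => y y0; rewrite /flat y0.
  have dV := is_deriveV tn (is_derive_id t (1 : R)).
  have dX := is_deriveX m dV.
  pose N (y : R) := - y^-1.
  have dN : is_derive t 1 N _ := is_deriveN dV.
  have dE : is_derive t 1 (expR \o N) _ :=
    is_derive1_comp (is_derive_expR (N t)) dN.
  have -> : (fun y : R => y^-1 ^+ m * expR (- y^-1)) =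
      (fun y : R => y^-1) ^+ m * (expR \o N).
    by apply/funext => y; rewrite !fctE.
  apply: is_derive_eq (is_deriveM dX dE) _.
  rewrite !fctE /flat t0 /GRing.scale /=; clear dX.
  case: m => [|m]; first by rewrite /N /=; field.
  by rewrite /N !exprS /=; field.
(* At 0 the difference quotient for y > 0 is [flat m.+1 y], which [flat_le] makes small. *)
- refine (is_derive_of_approx _) => e e0; rewrite t0 !(flat_le0 _ (lexx _)).
  have f0 : 0 < (m.+2)`!%:R :> R by rewrite ltr0n fact_gt0.
  apply: filterS (near_norm_lt 0 (divr_gt0 e0 f0)) => y.
  rewrite ltr_pdivlMr // mulr0 addr0 mul0r !subr0 => /ltW hy.
  rewrite (ger0_norm (flat_ge0 _ _)).
  have [y0|y0] := leP y 0; first by rewrite flat_le0 // mulr_ge0 // ltW.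
  have -> : flat m y = flat m.+1 y * y.
    by rewrite /flat y0 exprS; field; rewrite gt_eqF.
  rewrite (gtr0_norm y0) in hy *; rewrite ler_pM2r //.
  by apply: le_trans (flat_le _ (ltW y0)) _; rewrite mulrC.
Qed.

Lemma smooth_real_cst_lin n phi psi a :
  smooth_real n phi -> smooth_real n psi ->
  smooth_real n (fun s => a * phi s + psi s).
Proof.
elim: n phi psi => [//|n IH] phi psi [phi' dphi sphi] [psi' dpsi spsi].
exists (fun s => a * phi' s + psi' s); last exact: IH.
by move=> s; have := is_deriveD (is_deriveZ a (dphi s)) (dpsi s).
Qed.

Lemma flat_smooth n m : smooth_real n (flat m).
Proof.
elim: n m => [//|n IH] m; exists (fun t => - m%:R * flat m.+1 t + flat m.+2 t).
  exact: flat_deriv.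
exact: smooth_real_cst_lin.
Qed.

Lemma flat_MVT s t : s < t ->
  exists2 c, 0 <= c <= 2 & flat 0 t - flat 0 s = c * (t - s).
Proof.
move=> st; have d (u : R) : is_derive u 1 (flat 0) (flat 2 u).
  by apply: is_derive_eq (flat_deriv 0 u) _; rewrite oppr0 mul0r add0r.
have cf : {within `[s, t], continuous (flat 0)}.
  by apply: derivable_within_continuous => u _; exact: ex_derive.
have [u _ ->] := MVT st (fun u _ => d u) cf.
exists (flat 2 u) => //; rewrite flat_ge0 /=.
have [u0|u0] := leP u 0; first by rewrite flat_le0.
rewrite /flat u0 expRN ler_pdivrMr ?expR_gt0 //.
have u1 : 0 <= u^-1 by rewrite invr_ge0 ltW.
(* The bound 2 for theta' = y^2 e^-y, y = 1/u, comes from y^2/2 <= e^y. *)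
have := expR_ge1Dxn 1 u1; rewrite (_ : 2`! = 2%N) // => h.
by rewrite mulrC -ler_pdivrMr //; apply: le_trans h; rewrite lerDr.
Qed.

Lemma flat_homo s t : s <= t -> flat 0 s <= flat 0 t.
Proof.
rewrite le_eqVlt => /predU1P[-> //|st].
have [c /andP[c0 _] h] := flat_MVT st.
by rewrite -subr_ge0 h mulr_ge0 // subr_ge0 ltW.
Qed.

Lemma flat_lipschitz s t : `|flat 0 s - flat 0 t| <= 2 * `|s - t|.
Proof.
have main a b : a < b -> `|flat 0 b - flat 0 a| <= 2 * `|b - a|.
  move=> ab; have [c /andP[c0 c2] ->] := flat_MVT ab.
  by rewrite normrM ler_wpM2r // ger0_norm.
case: (ltgtP s t) => [st|st|->]; last by rewrite !subrr normr0 mulr0.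
  by rewrite (distrC (flat 0 s)) (distrC s); exact: main.
exact: main.
Qed.

Lemma flat_le1 t : flat 0 t <= 1.
Proof.
rewrite /flat; case: ifP => // t0; rewrite expr0 mul1r.
by rewrite -expR0 ler_expR oppr_le0 invr_ge0 ltW.
Qed.

Lemma flat1 : flat 0 1 = (expR 1)^-1.
Proof. by rewrite /flat ltr01 expr0 mul1r invr1 expRN. Qed.

(* [wide] is large enough for [slope] to be 1/2-Lipschitz: then it is a bump
   with [slope 0 = 1] whose graph meets the line [s + 1] only at [s = 0]. *)
Definition wide : R := 8 * (expR 1) ^+ 2.

Definition slope s : R :=
  (expR 1) ^+ 2 * (flat 0 (1 - s / wide) * flat 0 (1 + s / wide)).

Lemma wide_gt0 : 0 < wide.
Proof. by rewrite /wide mulr_gt0 // exprn_gt0 // expR_gt0. Qed.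

Lemma slope0 : slope 0 = 1.
Proof.
rewrite /slope mul0r subr0 addr0 flat1; have := expR_gt0 (1 : R).
by move=> /lt0r_neq0 ?; field.
Qed.

Lemma slope_bound s : `|slope s| <= (expR 1) ^+ 2.
Proof.
have e0 : 0 <= (expR 1 : R) ^+ 2 by rewrite exprn_ge0 // expR_ge0.
rewrite /slope !ger0_norm ?mulr_ge0 ?flat_ge0 //.
by rewrite ler_piMr // mulr_ile1 ?flat_ge0 ?flat_le1.
Qed.

Lemma slope_eq0 s : wide <= `|s| -> slope s = 0.
Proof.
have w0 := wide_gt0; rewrite ler_normr => /orP[h|h]; rewrite /slope.
  rewrite [flat 0 (1 - _)]flat_le0 ?mul0r ?mulr0 //.
  by rewrite subr_le0 ler_pdivlMr // mul1r.
rewrite [flat 0 (1 + _)]flat_le0 ?mulr0 //.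
by rewrite -lerBrDl sub0r ler_pdivrMr // mulN1r lerNr.
Qed.

(** Each flat factor is bounded by 1 and 2/wide-Lipschitz, so the product with e^2 has constant 4
    e^2/wide; the 8 in [wide] makes this 1/2. *)
Lemma slope_lipschitz s t : `|slope s - slope t| <= 2^-1 * `|s - t|.
Proof.
have w0 := wide_gt0; have E0 : 0 < (expR 1 : R) ^+ 2.
  by rewrite exprn_gt0 // expR_gt0.
pose a u := flat 0 (1 - u / wide); pose b u := flat 0 (1 + u / wide).
have -> : slope s - slope t =
    (expR 1) ^+ 2 * ((a s - a t) * b s + a t * (b s - b t)).
  by rewrite /slope -/(a _) -/(b _) -/(a t) -/(b t); ring.
have n1 u : `|flat 0 u| <= 1 by rewrite ger0_norm ?flat_ge0 ?flat_le1.
have la : `|a s - a t| <= 2 * (`|s - t| / wide).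
  apply: le_trans (flat_lipschitz _ _) _; rewrite ler_pM2l //.
  have -> : 1 - s / wide - (1 - t / wide) = - ((s - t) / wide) by ring.
  by rewrite normrN normrM normfV (gtr0_norm w0).
have lb : `|b s - b t| <= 2 * (`|s - t| / wide).
  apply: le_trans (flat_lipschitz _ _) _; rewrite ler_pM2l //.
  have -> : 1 + s / wide - (1 + t / wide) = (s - t) / wide by ring.
  by rewrite normrM normfV (gtr0_norm w0).
rewrite normrM (gtr0_norm E0).
apply: (@le_trans _ _ (expR 1 ^+ 2 * (4 * (`|s - t| / wide)))).
  rewrite ler_pM2l //; apply: le_trans (ler_normD _ _) _.
  have := ler_normM la (n1 (1 + s / wide)).
  have := ler_normM (n1 (1 - t / wide)) lb; rewrite -/(a _) -/(b _); lra.
rewrite /wide le_eqVlt; apply/orP; left; apply/eqP.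
by field; rewrite gt_eqF // expR_gt0.
Qed.

(** A smooth step from 1 (t <= r/2) to 0 (t >= r). The argument of the outer [flat 0] is at most 0
    in the first range and equal to 1 in the second, where [expR 1] normalises [flat 0 1]. Nesting
    avoids a quotient of functions, for which a further smoothness rule would be required. *)
Definition cutoff (r t : R) : R :=
  1 - expR 1 * flat 0 (1 - flat 0 (r - t) / flat 0 (r / 2)).

Lemma cutoff_eq1 r t : 0 < r -> t <= r / 2 -> cutoff r t = 1.
Proof.
move=> r0 tr; rewrite /cutoff flat_le0 ?mulr0 ?subr0 //.
have r2 : 0 < flat 0 (r / 2) by rewrite flat_gt0 // divr_gt0.
by rewrite subr_le0 ler_pdivlMr // mul1r flat_homo //; lra.
Qed.

Lemma cutoff_eq0 r t : r <= t -> cutoff r t = 0.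
Proof.
move=> rt; rewrite /cutoff (flat_le0 _ (_ : r - t <= 0)) ?subr_le0 //.
by rewrite mul0r subr0 flat1 divff ?subrr // gt_eqF // expR_gt0.
Qed.

Lemma cutoff_bounds r t : 0 <= cutoff r t <= 1.
Proof.
rewrite /cutoff subr_ge0 gerBl mulr_ge0 ?expR_ge0 ?flat_ge0 // andbT.
rewrite mulrC -ler_pdivlMr ?expR_gt0 // mul1r -flat1 flat_homo // gerBl.
by rewrite divr_ge0 // flat_ge0.
Qed.

End FlatFunction.

Section FlatSmoothness.
Context (R : realType) (X : normedModType R).

Lemma Cnf_flat n (f : X -> R) (U : set X) a c : open U -> Cnf n f U ->
  Cnf n (fun x => flat 0 (a + c * f x)) U.
Proof.
move=> oU cf.
apply: (Cnf_comp_real (f := fun x => a + c * f x) oU (flat_smooth R n.+1 0)).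
by apply: CnfD => //; [exact: Cnf_cst|apply: CnfM => //; exact: Cnf_cst].
Qed.

Lemma eq_Cnf n (f g : X -> R) (U : set X) : open U ->
  (forall x, U x -> f x = g x) -> Cnf n f U -> Cnf n g U.
Proof.
move=> oU fg; apply: Cn_eq => // x Ux.
by rewrite /as_family fg.
Qed.

Lemma Cnf_slope n (f : X -> R) (U : set X) : open U -> Cnf n f U ->
  Cnf n (fun x => slope (f x)) U.
Proof.
move=> oU cf; apply: CnfM => //; first exact: Cnf_cst.
apply: CnfM => //.
  apply: (eq_Cnf oU _ (Cnf_flat 1 (- (wide R)^-1) oU cf)) => x _.
  by rewrite mulNr mulrC.
apply: (eq_Cnf oU _ (Cnf_flat 1 (wide R)^-1 oU cf)) => x _.
by rewrite mulrC.
Qed.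

Lemma Cnf_cutoff n (f : X -> R) (U : set X) r : open U -> Cnf n f U ->
  Cnf n (fun x => cutoff r (f x)) U.
Proof.
move=> oU cf.
have c1 := Cnf_flat r (-1) oU cf.
have c2 := Cnf_flat 1 (- (flat 0 (r / 2))^-1) oU c1.
apply: (eq_Cnf oU _
  (CnfD oU (Cnf_cst n 1 oU) (CnfM oU (Cnf_cst n (- expR 1) oU) c2))) => x _.
by rewrite /cutoff mulN1r !mulNr [_^-1 * _]mulrC.
Qed.
End FlatSmoothness.

(** * The gauge of a starlike body *)

Section Minkowski.
Context (R : realType) (X : normedModType R).
Implicit Types (A : set X) (x y : X).

Lemma near_ray (Q : X -> Prop) (s : R) (y : X) :
  (\forall z \near s *: y, Q z) ->
  exists2 d : R, 0 < d & forall t, `|t - s| < d -> Q (t *: y).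
Proof.
move/nbhs_normP => [d /= d0 dQ]; have y1 : 0 < `|y| + 1 by rewrite ltr_wpDl.
exists (d / (`|y| + 1)); first exact: divr_gt0.
move=> t; rewrite ltr_pdivlMr // => td; apply: dQ => /=.
rewrite -scalerBl normrZ distrC; apply: le_lt_trans td.
by rewrite ler_wpM2l // lerDl.
Qed.

Section Starlike.
Variable A : set X.
Hypothesis starA : starlike_body A.

Lemma starlike_scale y t : 0 <= t <= 1 -> A y -> A (t *: y).
Proof.
(* Otherwise the ray through y has a boundary point on each side of t y. *)
case: starA => cA [A0 bA] /andP[t0 t1] Ay; apply: contrapT => nA.
have y0 : y != 0.
  apply/eqP => y0; apply: nA; rewrite y0 scaler0; exact: interior_subset A0.
have cAE z : closure A z -> A z by move=> ?; apply: cA.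
pose S := [set s : R | s <= t /\ A (s *: y)].
pose T := [set s : R | t <= s /\ A (s *: y)].
have [d d0 dA] : exists2 d : R, 0 < d & forall s, `|s - 0| < d -> A (s *: y).
  by apply: near_ray; rewrite scale0r.
have S0 : S 0.
  split=> //; rewrite scale0r; exact: interior_subset A0.
have T1 : T 1 by split; rewrite ?scale1r.
have hS : has_sup S by split; [exists 0|exists t => s []].
have hT : has_inf T by split; [exists 1|exists t => s []].
set a := sup S; set b := inf T.
have aub s : S s -> s <= a by move=> Ss; apply: ub_le_sup => //; case: hS.
have blb s : T s -> b <= s by move=> Ts; apply: ge_inf => //; case: hT.
have cla : closure A (a *: y).
  move=> Q /near_ray [e e0 eQ]; have [s Ss sa] := sup_adherent e0 hS.
  exists (s *: y); split; first by case: Ss.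
  by apply: eQ; have := aub s Ss; rewrite ltr_distl -/a in sa *; lra.
have clb : closure A (b *: y).
  move=> Q /near_ray [e e0 eQ]; have [s Ts sb] := inf_adherent e0 hT.
  exists (s *: y); split; first by case: Ts.
  by apply: eQ; have := blb s Ts; rewrite ltr_distl -/b in sb *; lra.
have ne s : A (s *: y) -> s != t.
  by move=> As; apply/eqP => st; rewrite st in As.
have at_ : a < t.
  rewrite lt_neqAle ne ?andTb; last exact: cAE.
  by apply: ge_sup => [|s []//]; exists 0.
have tb : t < b.
  rewrite lt_neqAle eq_sym ne ?andTb; last exact: cAE.
  by apply: lb_le_inf => [|s []//]; exists 1.
(* The starlike condition compares positive multiples only, so the lower boundary point must be kept
   off the origin; a ball inside [A] does this. *)
have a0 : 0 < a.
  set s := Num.min (d / 2) t.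
  have tpos : 0 < t by have := aub 0 S0; lra.
  have s0 : 0 < s by rewrite lt_min tpos divr_gt0.
  apply: (lt_le_trans s0 (aub _ _)); split; first by rewrite ge_min lexx orbT.
  apply: dA; rewrite subr0 gtr0_norm //; apply: (@le_lt_trans _ _ (d / 2)).
    by rewrite ge_min lexx.
  lra.
have ba : boundary A (a *: y).
  split=> // /near_ray [e e0 eA].
  set r := Num.min (e / 2) (t - a).
  have r0 : 0 < r by rewrite lt_min subr_gt0 at_ divr_gt0.
  have : S (a + r).
    split; first by rewrite -lerBrDl ge_min lexx orbT.
    apply: eA; rewrite addrC addKr gtr0_norm //.
    by apply: (@le_lt_trans _ _ (e / 2)); [rewrite ge_min lexx|lra].
  by move=> /aub; rewrite gerDl leNgt r0.
have bb : boundary A (b *: y).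
  split=> // /near_ray [e e0 eA].
  set r := Num.min (e / 2) (b - t).
  have r0 : 0 < r by rewrite lt_min subr_gt0 tb divr_gt0.
  have : T (b - r).
    split; first by rewrite lerBrDl -lerBrDr ge_min lexx orbT.
    apply: eA; rewrite addrC addKr normrN gtr0_norm //.
    by apply: (@le_lt_trans _ _ (e / 2)); [rewrite ge_min lexx|lra].
  by move=> /blb; rewrite lerBrDr gerDl leNgt r0.
have b0 : 0 < b by lra.
have := bA y y0 a b a0 b0 ba bb; lra.
Qed.

Let q := Defs.minkowski A.
Let E x := [set l : R | 0 < l /\ A (l^-1 *: x)].

Lemma starlike_ball : exists2 rho : R, 0 < rho & forall x, `|x| < rho -> A x.
Proof.
case: starA => _ [/nbhs_normP[d /= d0 dA] _]; exists d => // x xd.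
by apply: dA; rewrite /= sub0r normrN.
Qed.

Lemma minkowski_set_neq0 x : E x !=set0.
Proof.
have [d d0 dA] := starlike_ball; have l0 : 0 < `|x| / d + 1.
  by rewrite ltr_wpDl // divr_ge0 // ltW.
exists (`|x| / d + 1); split=> //; apply: dA.
rewrite normrZ normfV (gtr0_norm l0) mulrC ltr_pdivrMr // mulrDr mulr1.
by rewrite mulrCA divff ?gt_eqF // mulr1 ltrDl.
Qed.

Lemma minkowski_has_inf x : has_inf (E x).
Proof.
split; first exact: minkowski_set_neq0.
by exists 0 => l [/ltW].
Qed.

Lemma minkowski_ge0 x : 0 <= q x.
Proof. by apply: lb_le_inf; [exact: minkowski_set_neq0|move=> l [/ltW]]. Qed.

Lemma minkowski_le x l : 0 < l -> A (l^-1 *: x) -> q x <= l.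
Proof. by move=> l0 Al; apply: ge_inf; [case: (minkowski_has_inf x)|]. Qed.

Lemma minkowski_lt x l : q x < l -> A (l^-1 *: x).
Proof.
move=> ql; have l0 : 0 < l by exact: le_lt_trans (minkowski_ge0 x) ql.
have e0 : 0 < l - q x by rewrite subr_gt0.
have [s [s0 As]] := inf_adherent e0 (minkowski_has_inf x).
rewrite -/(q x) subrKC => sl.
have -> : l^-1 *: x = (s / l) *: (s^-1 *: x).
  by rewrite scalerA mulrAC divff ?mul1r // gt_eqF.
apply: starlike_scale As; rewrite divr_ge0 ?(ltW s0) ?(ltW l0) //=.
by rewrite ler_pdivrMr // mul1r ltW.
Qed.

Lemma minkowski_homogeneous t x : 0 < t -> q (t *: x) = t * q x.
Proof.
have main s y : 0 < s -> q (s *: y) <= s * q y.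
  move=> s0; apply/ler_addgt0Pl => e e0; rewrite addrC.
  have es : 0 < e / s by rewrite divr_gt0.
  have -> : s * q y + e = s * (q y + e / s) by field; rewrite gt_eqF.
  have l0 : 0 < q y + e / s by rewrite ltr_wpDl // minkowski_ge0.
  apply: minkowski_le; first exact: mulr_gt0.
  rewrite scalerA invfM mulrAC mulVf ?gt_eqF // mul1r.
  by apply: minkowski_lt; rewrite ltrDl.
move=> t0; apply/eqP; rewrite eq_le main //=.
have := main t^-1 (t *: x); rewrite invr_gt0 => /(_ t0).
by rewrite scalerA mulVf ?gt_eqF // scale1r ler_pdivlMl.
Qed.

Lemma minkowski_upper : exists2 C : R, 0 < C & forall x, q x <= C * `|x|.
Proof.
have [d d0 dA] := starlike_ball; exists (2 / d); first exact: divr_gt0.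
move=> x; have [->|x0] := eqVneq x 0.
  rewrite normr0 mulr0; apply/ler_addgt0Pl => e e0; rewrite addr0.
  by apply: minkowski_le => //; rewrite scaler0; apply: dA; rewrite normr0.
have nx : 0 < `|x| by rewrite normr_gt0.
have l0 : 0 < 2 / d * `|x| by rewrite mulr_gt0 // divr_gt0.
apply: minkowski_le => //; apply: dA.
rewrite normrZ normfV (gtr0_norm l0) mulrC ltr_pdivrMr //.
have -> : d * (2 / d * `|x|) = 2 * `|x| by field; rewrite gt_eqF.
lra.
Qed.

Lemma minkowski_lower : [bounded x | x in A] ->
  exists2 c : R, 0 < c & forall x, c * `|x| <= q x.
Proof.
move=> /pinfty_ex_gt0 [M M0 bA]; exists M^-1; first by rewrite invr_gt0.
move=> x; apply: lb_le_inf; first exact: minkowski_set_neq0.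
move=> l [l0 Al]; have := bA _ Al; rewrite /= normrZ normfV (gtr0_norm l0).
by rewrite !ler_pdivrMl // mulrC.
Qed.

Lemma minkowski_le1 x : A x -> q x <= 1.
Proof. by move=> Ax; apply: (@minkowski_le x 1); rewrite ?invr1 ?scale1r. Qed.

Lemma minkowski_lt1 x : q x < 1 -> A x.
Proof. by move=> /(@minkowski_lt x 1); rewrite invr1 scale1r. Qed.

(** A slightly larger multiple of [x] still lies in [A], and homogeneity turns its bound 1 into a
    strict one at [x]. *)
Lemma interior_minkowski_lt1 x : interior A x -> q x < 1.
Proof.
move=> Ax; have [d d0 dA] : exists2 d : R, 0 < d &
    forall t, `|t - 1| < d -> A (t *: x).
  by apply: near_ray; rewrite scale1r.
have t0 : 0 < 1 + d / 2 by rewrite addr_gt0 // divr_gt0.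
have /minkowski_le1 : A ((1 + d / 2) *: x).
  by apply: dA; rewrite addrC addKr gtr0_norm ?divr_gt0 //; lra.
rewrite minkowski_homogeneous // => h.
have q0 := minkowski_ge0 x.
have : 0 <= d / 2 * q x by rewrite mulr_ge0 // ltW // divr_gt0.
have [q1|//] := leP 1 (q x); have : 0 < d / 2 * q x.
  by rewrite mulr_gt0 ?divr_gt0 //; lra.
lra.
Qed.

(** Each x in [A] is the limit of (1 - s) x, where the gauge is below 1. This makes the support of
    the bump all of [A], boundary included. *)
Lemma closure_minkowski_lt1 : closure [set x | q x < 1] = A.
Proof.
apply/seteqP; split=> x.
  case: starA => cA _ clx; apply: cA => Q /clx [y [/= y1 Qy]].
  by exists y; split=> //; exact: minkowski_lt1.
move=> Ax Q Qx; have [d d0 dQ] : exists2 d : R, 0 < d &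
    forall t, `|t - 1| < d -> Q (t *: x).
  by apply: near_ray; rewrite scale1r.
set s := Num.min (d / 2) 2^-1.
have s0 : 0 < s by rewrite lt_min divr_gt0 //= invr_gt0.
have s1 : s <= 2^-1 by rewrite ge_min lexx orbT.
have sd : s <= d / 2 by rewrite ge_min lexx.
exists ((1 - s) *: x); split=> /=; last first.
  by apply: dQ; rewrite addrC addKr normrN gtr0_norm //; lra.
rewrite minkowski_homogeneous; last lra.
have := minkowski_le1 Ax; have := minkowski_ge0 x => q0 q1.
apply: (@le_lt_trans _ _ (1 - s)); last lra.
by rewrite ler_piMr //; lra.
Qed.

End Starlike.
End Minkowski.

(** * A separated sequence *)

Section SeparatedSequence.
Context (R : realType) (X : normedModType R).

(** Positive [t] suffice, which matters because the gauge is homogeneous only for positive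
    factors. *)
Lemma fderiv_along (P : Type) (w : P -> R) (F : X -> P -> R) x L u p c :
  is_fderiv w F x L -> (forall t, 0 < t -> F (x + t *: u) p = F x p + t * c) ->
  L (u, p) = c.
Proof.
move=> dF Fu; apply/eqP; rewrite -subr_eq0 -normr_le0.
apply/ler_addgt0Pl => e e0; rewrite addr0.
have k1 : 0 < `|(`|u| * w p)| + 1 by rewrite ltr_wpDl.
have [t t0] := near_line u (fderiv_approx dF (divr_gt0 e0 k1)).
have -> : x + t *: u - x = t *: u by rewrite addrC addKr.
move=> /(_ p); rewrite Fu // (fderiv_linZ _ _ _ dF) [`|t *: u|]normrZ.
rewrite (gtr0_norm t0).
have -> : F x p + t * c - F x p - t * L (u, p) = - (t * (L (u, p) - c)) by ring.
rewrite normrN [`|t * _|]normrM (gtr0_norm t0) -mulrA mulrCA ler_pM2l // => h.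
apply: le_trans h _; rewrite mulrAC ler_pdivrMr // ler_wpM2l ?(ltW e0) //.
by apply: le_trans (ler_norm _) _; rewrite lerDl.
Qed.

Definition bounded_functional (f : X -> R) : Prop :=
  (forall a u v, f (a *: u + v) = a * f u + f v) /\
  (exists2 M, 0 <= M & forall u, `|f u| <= M * `|u|).

Definition bounded_operator (T : X -> X) : Prop :=
  (forall a u v, T (a *: u + v) = a *: T u + T v) /\
  (exists2 M, 0 <= M & forall u, `|T u| <= M * `|u|).

Definition subspace (K : X -> Prop) : Prop :=
  K 0 /\ forall a u v, K u -> K v -> K (a *: u + v).

(** Euler's identity q'(v) v = q(v): the normalised derivative of the gauge does the work of
    Hahn-Banach. *)
Lemma homogeneous_functional (q : X -> R) v L :
  (forall t x, 0 < t -> q (t *: x) = t * q x) -> 0 < q v ->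
  is_fderiv unit_weight (as_family q) v L ->
  exists2 f, bounded_functional f & f v = 1.
Proof.
move=> hq qv dq.
have Lv : L (v, tt) = q v.
  apply: (fderiv_along dq) => t t0; rewrite /as_family.
  rewrite -{1}[v]scale1r -scalerDl hq ?addr_gt0 //; ring.
case: dq => lL [M M0 bL] _; exists (fun u => (q v)^-1 * L (u, tt)).
  split; first by move=> a u v'; rewrite lL; ring.
  exists ((q v)^-1 * M); first by rewrite mulr_ge0 // invr_ge0 ltW.
  move=> u; have := bL (u, tt); rewrite /diff_weight /unit_weight mulr1 => h.
  by rewrite normrM gtr0_norm ?invr_gt0 // -mulrA ler_wpM2l // invr_ge0 ltW.
by rewrite Lv mulVf // gt_eqF.
Qed.

(** The subspace reached so far is carried as the kernel of a bounded operator. Inclusion in a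
    finite span is enough to find a vector outside it. *)
Definition finite_kernel (T : X -> X) : Prop :=
  exists n (v : 'I_n -> X), forall x, T x = 0 ->
    exists c : 'I_n -> R, x = \sum_(i < n) c i *: v i.

Hypothesis functionals :
  forall v : X, v != 0 -> exists2 f, bounded_functional f & f v = 1.
Hypothesis infX : infinite_dimensional X.

Lemma bounded_operator0 T : bounded_operator T -> T 0 = 0.
Proof.
case=> /(_ 1 0 0); rewrite !scale1r addr0 => h _.
by apply: (addrI (T 0)); rewrite -h addr0.
Qed.

Lemma bounded_operatorB T u v : bounded_operator T -> T (u - v) = T u - T v.
Proof.
by case=> /(_ (-1) v u) + _; rewrite !scaleN1r addrC => ->; rewrite addrC.
Qed.

Lemma bounded_operatorZ T a u : bounded_operator T -> T (a *: u) = a *: T u.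
Proof.
move=> bT; case: (bT) => /(_ a u 0) + _.
by rewrite (bounded_operator0 bT) !addr0.
Qed.

(* Riesz's lemma: the distance to [ker T] is positive outside [ker T] because
   [T] is bounded, so no compactness of finite-dimensional balls is needed;
   the kernel of [T'] is then [ker T + R e]. *)
Lemma riesz_step (delta : R) (T : X -> X) : 0 < delta ->
  bounded_operator T -> finite_kernel T ->
  exists (e : X) (T' : X -> X), bounded_operator T' /\ finite_kernel T' /\
    `|e| <= delta /\ T' e = 0 /\ (forall x, T x = 0 -> T' x = 0) /\
    (forall v, T v = 0 -> delta / 2 <= `|e - v|).
Proof.
move=> d0 bT [n [b kerT]]; have [x xb] := infX b.
have Tx : T x != 0 by apply/eqP => /kerT [c /xb].
have [lT [M M0 MT]] := bT.
have Mx : 0 < M.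
  rewrite lt_neqAle M0 andbT; apply/eqP => M1.
  by have := MT x; rewrite -M1 mul0r normr_le0 (negbTE Tx).
pose D := [set r : R | exists2 v, T v = 0 & r = `|x - v|].
have D0 : D !=set0.
  by exists `|x - 0|; exists 0 => //; exact: bounded_operator0.
set d := inf D.
have dlb r : D r -> d <= r.
  by move=> Dr; apply: ge_inf => //; exists 0 => ? [v _ ->].
have dpos : 0 < d.
  apply: (@lt_le_trans _ _ (`|T x| / M)); first by rewrite divr_gt0 ?normr_gt0.
  apply: lb_le_inf => // r [v Tv ->]; rewrite ler_pdivrMr // mulrC.
  by apply: le_trans (MT _); rewrite bounded_operatorB // Tv subr0.
(* The distance need not be attained; a kernel vector within twice the distance accounts for the
   factor 1/2 in the conclusion. *)
have [r [v Tv ->]] : exists2 r, D r & r < d + d.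
  by apply: inf_adherent => //; split=> //; exists 0 => ? [v _ ->].
set N := `|x - v| => Nd.
have N0 : 0 < N by apply: lt_le_trans dpos (dlb _ _); exists v.
pose e := (delta / N) *: (x - v).
have dN : 0 < delta / N by rewrite divr_gt0.
have ne : `|e| = delta.
  by rewrite /e normrZ gtr0_norm // -/N divfK // gt_eqF.
have Te : T e != 0.
  rewrite /e bounded_operatorZ // bounded_operatorB // Tv subr0.
  by rewrite scaler_eq0 negb_or gt_eqF.
(* Following [T] by the projection along [T e] onto ker g kills [e] in addition to ker T. *)
have [g [lg [G G0 bg]] gT] := functionals Te.
exists e, (fun y => T y - g (T y) *: T e).
split; [|split; [|split; [|split; [|split]]]].
- split=> [a u w|].
    rewrite lT lg scalerBr scalerDl opprD addrACA; congr (_ + _).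
    by rewrite scalerA.
  exists (M + G * M * `|T e|); first by rewrite addr_ge0 // !mulr_ge0.
  move=> u; apply: le_trans (ler_normB _ _) _; rewrite mulrDl lerD // normrZ.
  rewrite mulrAC ler_wpM2r // -mulrA; apply: le_trans (bg _) _.
  by rewrite ler_wpM2l.
- exists n.+1, (ext0 e b) => y /eqP; rewrite subr_eq0 => /eqP Ty.
  have /kerT [c yc] : T (y - g (T y) *: e) = 0.
    by rewrite bounded_operatorB // bounded_operatorZ // -Ty subrr.
  exists (fun i => if unlift ord0 i is Some j then c j else g (T y)).
  rewrite big_ord_recl /ext0 unlift_none.
  under eq_bigr => i _ do rewrite liftK.
  by rewrite -yc subrKC.
- by rewrite ne.
- by rewrite gT scale1r subrr.
- move=> y Ty; have /= -> : g (T y) = 0.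
    by rewrite Ty; have := lg 1 0 0; rewrite scaler0 addr0 mul1r => ?; lra.
  by rewrite scale0r subr0.
- move=> w Tw.
  have -> : e - w = (delta / N) *: (x - (v + (N / delta) *: w)).
    rewrite opprD addrA scalerBr scalerA -/e.
    have -> : delta / N * (N / delta) = 1 by field; rewrite !gt_eqF.
    by rewrite scale1r.
  have dle : d <= `|x - (v + (N / delta) *: w)|.
    apply: dlb; exists (v + (N / delta) *: w) => //.
    by rewrite addrC lT Tw Tv scaler0 addr0.
  rewrite normrZ gtr0_norm // mulrAC ler_pdivlMr // mulrAC ler_pdivrMr //.
  have : delta * N <= delta * (2 * d) by rewrite ler_pM2l //; lra.
  have : delta * (2 * d) <= delta * (2 * `|x - (v + (N / delta) *: w)|).
    by rewrite !ler_pM2l.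
  lra.
Qed.

(** [K n], the kernel of the n-th operator, plays the role of the span of e_0, ..., e_n; the
    recursion starts from the identity, whose kernel is the origin. *)
Lemma separated_sequence (delta : R) : 0 < delta ->
  exists (e : nat -> X) (K : nat -> X -> Prop),
    e 0%N = 0 /\ (forall n, `|e n| <= delta) /\ (forall n, subspace (K n)) /\
    (forall i n, (i <= n)%N -> K n (e i)) /\
    (forall n v, K n v -> delta / 2 <= `|e n.+1 - v|).
Proof.
move=> d0.
pose good (T : X -> X) := bounded_operator T /\ finite_kernel T.
pose st := {T : X -> X | good T}.
have step (s : X * st) : {s' : X * st | `|s'.1| <= delta /\
    projT1 s'.2 s'.1 = 0 /\
    (forall x, projT1 s.2 x = 0 -> projT1 s'.2 x = 0) /\
    (forall v, projT1 s.2 v = 0 -> delta / 2 <= `|s'.1 - v|)}.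
  case: s => x [T [bT kT]]; apply: cid.
  have [e [T' [bT' [kT' [h1 [h2 [h3 h4]]]]]]] := riesz_step d0 bT kT.
  by exists (e, exist _ T' (conj bT' kT')).
have gid : good id.
  split; first by split=> //; exists 1 => // u; rewrite mul1r.
  exists 0%N, (fun=> 0) => x ->; exists (fun=> 0); by rewrite big_ord0.
pose s := fix s n : X * st :=
  if n is m.+1 then projT1 (step (s m)) else (0, exist _ id gid).
have sP n := projT2 (step (s n)).
exists (fun n => (s n).1), (fun n x => projT1 (s n).2 x = 0).
split; [by []|split; [|split; [|split]]].
- by case=> [|n]; [rewrite normr0 ltW|case: (sP n)].
- move=> n; case: (s n).2 => T [bT _] /=; split.
    exact: bounded_operator0.
  by move=> a u v Tu Tv; case: bT => -> _; rewrite Tu Tv scaler0 addr0.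
- move=> i n; elim: n => [|n IH]; first by rewrite leqn0 => /eqP ->.
  rewrite leq_eqVlt => /predU1P[->|]; first by case: (sP n) => _ [].
  by rewrite ltnS => /IH; case: (sP n) => _ [_ [h _]] /h.
- by move=> n v; case: (sP n) => _ [_ [_ h]] /h.
Qed.

End SeparatedSequence.

(** * Distance between the axes of the tubes *)

Section Segments.
Context (R : realType) (X : normedModType R).

Lemma subspace_dist (K : X -> Prop) (e : X) (d a : R) (w : X) : subspace K ->
  (forall v, K v -> d <= `|e - v|) -> K w -> `|a| * d <= `|a *: e - w|.
Proof.
move=> [K0 Klin] eK Kw; have [->|a0] := eqVneq a 0.
  by rewrite normr0 mul0r.
have -> : a *: e - w = a *: (e - a^-1 *: w).
  by rewrite scalerBr scalerA divff // scale1r.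
rewrite normrZ ler_wpM2l //; apply: eK.
by rewrite -[_ *: w]addr0; exact: Klin.
Qed.

Definition seg (e : nat -> X) (n : nat) (s : R) : X :=
  e n.+1 + s *: (e n.+1 - e n).

(** With m replaced by m + 1, z = (1+t) e_{m+2} - t e_{m+1}, and the coefficients cannot both be
    small. At distance D from x, separation from [K m.+1] gives |1+t| delta <= 2D; separation from
    [K m] then gives |t| delta <= 2(|1+t| delta + D) <= 6D, so delta <= 8D. Consecutive axes share a
    point, hence the gap of two. *)
Lemma segments_separated (delta : R) (e : nat -> X) (K : nat -> X -> Prop)
    (n m : nat) (s t : R) : 0 < delta ->
  (forall n, `|e n| <= delta) -> (forall n, subspace (K n)) ->
  (forall i n, (i <= n)%N -> K n (e i)) ->
  (forall n v, K n v -> delta / 2 <= `|e n.+1 - v|) ->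
  (n.+2 <= m)%N -> delta / 8 <= `|seg e m t - seg e n s|.
Proof.
move=> d0 ed sK eK dK; case: m => // m nm.
have Kx k : (m <= k)%N -> K k (seg e n s).
  move=> mk; have [K0 Klin] := sK k.
  rewrite /seg addrC; apply: (Klin); last by apply: (eK); lia.
  by rewrite addrC -scaleN1r; apply: (Klin); apply: (eK); lia.
set x := seg e n s in Kx *; set z := seg e m.+1 t.
have zE : z = (1 + t) *: e m.+2 - t *: e m.+1.
  by rewrite /z /seg scalerBr addrA scalerDl scale1r.
clearbody x z.
have h1 : `|1 + t| * (delta / 2) <= `|z - x|.
  have -> : z - x = (1 + t) *: e m.+2 - (t *: e m.+1 + x).
    by rewrite zE opprD addrA.
  apply: (subspace_dist _ (sK m.+1) (dK m.+1)).
  by apply: (sK m.+1).2; [exact: eK|exact: Kx].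
have h2 : `|t| * (delta / 2) <= `|t *: e m.+1 - (-1 *: x + 0)|.
  apply: (subspace_dist _ (sK m) (dK m)).
  by apply: (sK m).2; [exact: Kx|exact: (sK m).1].
have h3 : `|t *: e m.+1 - (-1 *: x + 0)| <= `|1 + t| * delta + `|z - x|.
  have -> : t *: e m.+1 - (-1 *: x + 0) = (1 + t) *: e m.+2 - (z - x).
    by rewrite zE addr0 scaleN1r opprK !opprD !opprK addrA addrA subrr add0r.
  apply: le_trans (ler_normB _ _) _; rewrite lerD2r normrZ ler_wpM2l //.
have h4 : 1 <= `|1 + t| + `|t|.
  rewrite -[leLHS](normr1 R) -{1}(addrK t 1); exact: ler_normB.
have h5 : delta <= (`|1 + t| + `|t|) * delta by rewrite ler_peMl // ltW.
lra.
Qed.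
End Segments.

(** * Deletion of the origin along tubes *)

Section Deletion.
Context (R : realType) (X : normedModType R).
Variables (q : X -> R) (c C : R) (p : smooth_order).
Hypotheses (c0 : 0 < c) (C0 : 0 < C).
Hypothesis q_lower : forall x, c * `|x| <= q x.
Hypothesis q_upper : forall x, q x <= C * `|x|.
Hypothesis q_homogeneous : forall t x, 0 < t -> q (t *: x) = t * q x.
Hypothesis q_smooth : forall k, order_le k p -> Cnf k q [set x | x != 0].
Hypothesis p_pos : order_le 1 p.

Let u0 := @unit_weight_ge0 R.

Lemma open_neq (a : X) : open [set x : X | x != a].
Proof.
have -> : [set x : X | x != a] = ~` [set a].
  by apply/seteqP; split=> x /= /eqP.
apply/closed_openC/accessible_closed_set1/hausdorff_accessible.
exact: norm_hausdorff.
Qed.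

Lemma gauge_gt0 x : x != 0 -> 0 < q x.
Proof.
by move=> x0; apply: lt_le_trans (q_lower x); rewrite mulr_gt0 // normr_gt0.
Qed.

Lemma gauge0 : q 0 = 0.
Proof.
apply/eqP; rewrite eq_le; have := q_lower 0; have := q_upper 0.
by rewrite normr0 !mulr0 => -> ->.
Qed.

(** The cutoff is constantly 1 on a ball around 0, which hides the singularity of [q]. *)
Lemma cutoff_gauge_smooth r k : 0 < r -> order_le k p ->
  Cnf k (fun x => cutoff r (q x)) setT.
Proof.
move=> r0 kp; apply: Cn_local => x _.
have [x0|x0] := eqVneq x 0; last first.
  exists [set x | x != 0] => //.
  exact: (Cnf_cutoff r (open_neq 0) (q_smooth kp)).
have d0 : 0 < r / 2 / C by rewrite !divr_gt0.
exists (ball (0 : X) (r / 2 / C)); first by rewrite x0; exact: ballxx.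
have oB : open (ball (0 : X) (r / 2 / C)) by exact: ball_open.
apply: (eq_Cnf oB _ (Cnf_cst k 1 oB)) => y.
rewrite -ball_normE /= sub0r normrN ltr_pdivlMr // => yd.
by rewrite cutoff_eq1 //; apply: le_trans (q_upper y) _; rewrite mulrC ltW.
Qed.

Lemma gauge_functional (v : X) :
  v != 0 -> exists2 f : X -> R, bounded_functional f & f v = 1.
Proof.
move=> v0.
have dq := Cnf_is_fderiv (q_smooth p_pos) (v0 : [set x | x != 0] v).
exact: (homogeneous_functional q_homogeneous (gauge_gt0 v0) dq).
Qed.

Lemma bounded_functionalB (f : X -> R) (u v : X) : bounded_functional f ->
  f (u - v) = f u - f v.
Proof.
by case=> /(_ (-1) v u) + _; rewrite scaleN1r mulN1r addrC => ->; rewrite addrC.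
Qed.

(** * A single tube *)

Section Tube.
Variables (a v : X) (f : X -> R) (r : R).
Hypotheses (bf : bounded_functional f) (fv : f v = 1) (r0 : 0 < r).

Definition tube_proj (x : X) : X := push f v (push (fun=> 1) a x).

(** The first factor depends on the position along the axis, the second on the projection of x - a
    to ker f along [v]; only the first varies in the direction [v]. *)
Definition tube_bump (x : X) : R :=
  slope (f (x - a)) * cutoff r (q (tube_proj x)).

Lemma tube_projE x : tube_proj x = x - a - f (x - a) *: v.
Proof. by rewrite /tube_proj /push scale1r. Qed.

Lemma tube_functionalD x t : f (x + t *: v - a) = f (x - a) + t.
Proof.
have -> : x + t *: v - a = t *: v + (x - a) by rewrite addrAC addrC.
by case: bf => -> _; rewrite fv mulr1 addrC.
Qed.

Lemma tube_projD x t : tube_proj (x + t *: v) = tube_proj x.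
Proof.
rewrite !tube_projE tube_functionalD scalerDl opprD addrA.
rewrite -[x + _ - a]addrA [t *: v - a]addrC addrA [X in X - t *: v]addrAC.
by rewrite addrK.
Qed.

Lemma tube_bump_center : tube_bump a = 1.
Proof.
have f0 : f 0 = 0 by rewrite -(subrr a) bounded_functionalB // subrr.
rewrite /tube_bump tube_projE subrr f0 scale0r subr0 slope0 mul1r gauge0.
by rewrite cutoff_eq1 // divr_ge0 // ltW.
Qed.

Lemma tube_bump_lipschitz x t :
  `|tube_bump (x + t *: v) - tube_bump x| <= 2^-1 * `|t|.
Proof.
rewrite /tube_bump tube_projD tube_functionalD -mulrBl normrM.
have /andP[k0 k1] := cutoff_bounds r (q (tube_proj x)).
rewrite (ger0_norm k0).
have := slope_lipschitz (f (x - a) + t) (f (x - a)).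
rewrite [_ + t]addrC addrK => h.
apply: (le_trans _ h); exact: ler_piMr.
Qed.

Lemma tube_bump_bound x : `|tube_bump x| <= expR 1 ^+ 2.
Proof.
rewrite /tube_bump normrM.
have /andP[k0 k1] := cutoff_bounds r (q (tube_proj x)).
rewrite (ger0_norm k0); apply: le_trans (slope_bound (f (x - a))).
exact: ler_piMr.
Qed.

Lemma tube_bump_support x : tube_bump x != 0 ->
  `|f (x - a)| <= wide R /\ `|x - (a + f (x - a) *: v)| <= r / c.
Proof.
rewrite /tube_bump mulf_eq0 negb_or => /andP[s0 k0]; split.
  rewrite leNgt; apply: contra s0 => h.
  by rewrite slope_eq0 // ltW.
rewrite opprD addrA -tube_projE ler_pdivlMr // mulrC.
apply: le_trans (q_lower _) _; rewrite leNgt; apply: contra k0 => h.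
by rewrite cutoff_eq0 // ltW.
Qed.

(** A preimage lies on the axis, x = a + (t - 1) v with t the value of the bump at x. Since the bump
    is 1 at [a], the Lipschitz bound yields |t - 1| <= |t - 1|/2. *)
Lemma tube_push_inj x : push tube_bump v x = a - v -> x = a.
Proof.
rewrite /push => h; set t := tube_bump x in h.
have xE : x = a + (t - 1) *: v.
  rewrite -(subrK (t *: v) x) h scalerBl scale1r.
  by rewrite -!addrA [- v + _]addrC.
have := tube_bump_lipschitz a (t - 1); rewrite -xE tube_bump_center -/t => h'.
have t1 : `|t - 1| <= 0 by lra.
by move: t1; rewrite normr_le0 => /eqP t1; rewrite xE t1 scale0r addr0.
Qed.

Lemma tube_bump_smooth k : order_le k p -> Cnf k tube_bump setT.
Proof.
move=> kp; have oT : open [set: X] by exact: openT.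
have cf : Cnf k f setT by case: bf => lf Mf; exact: Cnf_linear.
have c1 : Cnf k (fun=> 1) [set: X] by exact: Cnf_cst.
apply: CnfM => //.
  have := Cnf_slope oT (Cnf_push (v := a) oT (fun _ _ => I) c1 cf).
  by apply: eq_Cnf => // x _; rewrite /push scale1r.
apply: (Cnf_push (f := fun y => cutoff r (q (push f v y))) oT
  (fun _ _ => I) c1).
apply: (Cnf_push (f := fun y => cutoff r (q y)) oT (fun _ _ => I) cf).
exact: cutoff_gauge_smooth.
Qed.

Lemma tube_bump_deriv_neq1 x B :
  is_fderiv unit_weight (as_family tube_bump) x B -> B (v, tt) != 1.
Proof.
move=> dB; apply/eqP => B1; have v1 : 0 < 4 * (`|v| + 1).
  by rewrite mulr_gt0 // ltr_wpDl.
(* This tolerance keeps the error along [v] below t/4, while an increment of at most t/2 misses the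
   slope 1 by at least t/2. *)
have e0 : 0 < (4 * (`|v| + 1))^-1 by rewrite invr_gt0.
have [t t0 /(_ tt)] := near_line v (fderiv_approx dB e0).
have -> : x + t *: v - x = t *: v by rewrite addrC addKr.
rewrite (fderiv_linZ _ _ _ dB) B1 mulr1 /unit_weight mulr1 [`|t *: v|]normrZ.
have := tube_bump_lipschitz x t; rewrite /as_family (gtr0_norm t0).
set D := _ - tube_bump x => h1 h2.
have h3 : (4 * (`|v| + 1))^-1 * (t * `|v|) <= 4^-1 * t.
  rewrite mulrC ler_pdivrMr //.
  have -> : 4^-1 * t * (4 * (`|v| + 1)) = t * (`|v| + 1) by field.
  by rewrite ler_pM2l // lerDl.
have h4 := ler_normB D (D - t); rewrite opprB addrC subrK (gtr0_norm t0) in h4.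
lra.
Qed.

End Tube.

Definition nonzero_deriv (g : X -> R) (x : X) : Prop :=
  exists2 L, is_fderiv unit_weight (as_family g) x L &
    exists u, L (u, tt) != 0.

(* The derivative [u - B u v] of [push b v] is onto because [B v != 1]. *)
Lemma nonzero_deriv_push (g b : X -> R) (v x : X) B :
  is_fderiv unit_weight (as_family b) x B -> B (v, tt) != 1 ->
  nonzero_deriv g (push b v x) -> nonzero_deriv (fun y => g (push b v y)) x.
Proof.
move=> db Bv [L dL [w Lw]].
exists (fun up => L up - B (up.1, tt) * L (v, up.2)).
  exact: (is_fderiv_comp_push u0 dL db).
have Bv1 : 1 - B (v, tt) != 0 by rewrite subr_eq0 eq_sym.
(* This vector u solves u - B(u) v = w. *)
exists ((B (w, tt) / (1 - B (v, tt))) *: v + w) => /=.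
rewrite (fderiv_lin dL) (fderiv_lin db).
apply: contra Lw => /eqP h; apply/eqP; rewrite -[RHS]h; field.
by [].
Qed.

Lemma gauge_nonzero_deriv x : x != 0 -> nonzero_deriv q x.
Proof.
move=> x0; have dq := Cnf_is_fderiv (q_smooth p_pos) (x0 : [set y | y != 0] x).
exists (der unit_weight (as_family q) x) => //.
exists x; rewrite (fderiv_along (c := q x) dq) ?gt_eqF ?gauge_gt0 //.
move=> t t0; rewrite /as_family -{1}[x]scale1r -scalerDl.
by rewrite q_homogeneous ?addr_gt0 //; ring.
Qed.

Hypothesis infX : infinite_dimensional X.

Lemma gauge_without_critical_points : exists F : X -> R,
  (forall k, order_le k p -> Cnf k F setT) /\
  (forall x, nonzero_deriv F x) /\ (forall x, (F x < 1) = (q x < 1)).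
Proof.
pose E : R := expR 1 ^+ 2; pose W := wide R.
have E0 : 0 < E by rewrite exprn_gt0 // expR_gt0.
have W0 : 0 < W by exact: wide_gt0.
(* In units of [delta]: a point of a tube has norm at most 2 + 2W (axis point plus thickness), and a
   push moves it by at most 2E. The choice of [delta] gives C * a2 * delta = 1/2, so the gauge is
   below 1 on the ball of radius a2 * delta. *)
pose a2 := 2 + 2 * W + 2 * E.
have a20 : 0 < a2 by rewrite /a2; lra.
pose delta := (2 * C * a2)^-1.
have d0 : 0 < delta by rewrite invr_gt0 !mulr_gt0.
have [e [K [e0 [ed [sK [eK dK]]]]]] :=
  separated_sequence gauge_functional infX d0.
pose v n := e n.+1 - e n.
have v0 n : v n != 0.
  have := dK n (e n) (eK n n (leqnn n)); rewrite -normr_gt0.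
  by apply: lt_le_trans; rewrite divr_gt0.
have vd n : `|v n| <= 2 * delta.
  by apply: le_trans (ler_normB _ _) _; have := ed n; have := ed n.+1; lra.
have [f fP] : {f : nat -> X -> R |
    forall n, bounded_functional (f n) /\ f n (v n) = 1}.
  have h n : {g : X -> R | bounded_functional g /\ g (v n) = 1}.
    by apply: cid; have [g bg gv] := gauge_functional (v0 n); exists g.
  by exists (fun n => projT1 (h n)) => n; exact: projT2 (h n).
have bf n := (fP n).1; have fv n := (fP n).2.
(* The tube radius becomes delta/32: two tube radii and two ball radii of this size do not bridge
   the gap delta/8 between axes. *)
pose r := c * (delta / 32).
have r0 : 0 < r by rewrite /r !(mulr_gt0, divr_gt0).
have rc : r / c = delta / 32 by rewrite /r; field; rewrite gt_eqF.
pose b n := tube_bump (e n.+1) (v n) (f n) r.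
have supp n x : b n x != 0 -> exists2 s : R, `|s| <= W &
    `|x - seg e n s| <= delta / 32.
  by rewrite -rc => /tube_bump_support [? ?]; exists (f n (x - e n.+1)).
(* The new push is innermost, so [F m.+1] and [F m] agree wherever [b m] vanishes. *)
pose F := fix F n : X -> R :=
  if n is m.+1 then fun x => F m (push (b m) (v m) x) else q.
(* Only [e n.+1] is sent to [e n], so each push moves the single singular point from [e n] to
   [e n.+1]. *)
have pushN n x : x != e n.+1 -> push (b n) (v n) x != e n.
  move=> xe; apply: contra_neq xe => h.
  apply: (tube_push_inj (bf n) (fv n) r0).
  by rewrite -/(b n) h /v opprB subrKC.
have Fsmooth k n : order_le k p -> Cnf k (F n) [set x | x != e n].
  move=> kp; elim: n => [|n IH] /=; first by rewrite e0; exact: q_smooth.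
  apply: Cnf_push IH; [exact: open_neq|by move=> x /= /pushN|].
  by apply: Cnf_sub (tube_bump_smooth _ _ (bf n) r0 kp).
have Fderiv n x : x != e n -> nonzero_deriv (F n) x.
  elim: n x => [|n IH] x xe /=.
    by apply: gauge_nonzero_deriv; rewrite -e0.
  have db := Cnf_is_fderiv (tube_bump_smooth (e n.+1) (v n) (bf n) r0 p_pos)
    (I : setT x).
  apply: (nonzero_deriv_push db); last by apply: IH; exact: pushN.
  exact: tube_bump_deriv_neq1 db.
have loc x : {N | forall n, (N <= n)%N ->
    forall y, `|y - x| < delta / 32 -> b n y = 0}.
  apply: cid.
  have [[m [y yx by0]]|h] := pselect (exists m, exists2 y,
      `|y - x| < delta / 32 & b m y != 0); last first.
    exists 0%N => n _ y yx; apply/eqP; apply: contrapT => /negP by0.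
    by apply: h; exists n, y.
  exists m.+2 => n mn z zx; apply/eqP; apply: contrapT => /negP bz0.
  have [s _ ys] := supp _ _ by0; have [t _ zt] := supp _ _ bz0.
  have := segments_separated s t d0 ed sK eK dK mn.
  have := ler_distD z (seg e n t) (seg e m s).
  have := ler_distD x z (seg e m s); have := ler_distD y x (seg e m s).
  rewrite (distrC _ z) (distrC x y) => k1 k2 k3 k4; lra.
pose N x := projT1 (loc x).
have NP x n y : (N x <= n)%N -> `|y - x| < delta / 32 -> b n y = 0.
  by move=> Nn yx; apply: (projT2 (loc x)).
have FS n y : b n y = 0 -> F n.+1 y = F n y.
  by move=> by0; rewrite /= /push by0 scale0r subr0.
have Fstable x n y : (N x <= n)%N -> `|y - x| < delta / 32 ->
    F n y = F (N x) y.
  move=> + yx; elim: n => [|n IH]; first by rewrite leqn0 => /eqP <-.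
  rewrite leq_eqVlt => /predU1P[<- //|]; rewrite ltnS => Nn.
  by rewrite FS ?IH //; exact: NP yx.
pose G x := F (N x) x.
have GE x n y : (N x <= n)%N -> `|y - x| < delta / 32 -> G y = F n y.
  move=> Nn yx; rewrite /G (Fstable x n) //.
  rewrite -(Fstable x (maxn (N x) (N y))) ?leq_maxl //.
  by rewrite -(Fstable y (maxn (N x) (N y))) ?leq_maxr // subrr normr0 divr_gt0.
(* The stable index might be one at which [x] itself is the singular point. The next index gives the
   same function near [x], and its singular point is a different one. *)
have away x : {n | (N x <= n)%N & x != e n}.
  have [xe|xe] := eqVneq x (e (N x)); last by exists (N x).
  exists (N x).+1; first exact: leqnSn.
  by apply/eqP => xe'; have := v0 (N x); rewrite /v -xe' -xe subrr eqxx.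
have dd : 0 < delta / 32 by rewrite divr_gt0.
exists G; split; [|split].
- move=> k kp; apply: Cn_local => x _; have [n Nn xe] := away x.
  pose V := ball x (delta / 32) `&` [set y | y != e n].
  have oV : open V by apply: openI; [exact: ball_open|exact: open_neq].
  exists V; first by split=> //; exact: ballxx.
  apply: (eq_Cnf oV (f := F n)).
    by move=> y [+ _]; rewrite -ball_normE /= distrC => yx; rewrite (GE x n).
  by apply: Cnf_sub (Fsmooth k n kp) => y [].
- move=> x; have [n Nn xe] := away x; have [L dL Lu] := Fderiv n x xe.
  exists L => //; apply: eq_is_fderiv dL.
  apply: filterS (near_norm_lt x dd) => y yx; rewrite /as_family.
  by rewrite (GE x n).
(* This holds for every [F n]. All tubes lie in the ball of radius [R1], and pushes move points by
   at most R2 - R1; so the ball of radius [R2] is preserved, with both sides true on it, and outside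
   it [F n] is [q]. *)
- move=> x; rewrite /G; move: (N x) => n.
  pose R1 := delta * (2 + 2 * W); pose R2 := delta * a2.
  have R21 : R2 = R1 + E * (2 * delta) by rewrite /R2 /R1 /a2; ring.
  have CR2 : C * R2 < 1.
    rewrite /R2 /delta.
    have -> : C * ((2 * C * a2)^-1 * a2) = 2^-1 by field; rewrite !gt_eqF.
    by rewrite invf_lt1 // ltr1n.
  have small m y : b m y != 0 -> `|y| <= R1.
    move=> /supp [s sW ys]; have := ler_normD (y - seg e m s) (seg e m s).
    rewrite subrK => k1; have k2 := ler_normD (e m.+1) (s *: v m).
    have k3 : `|s *: v m| <= W * (2 * delta) by rewrite normrZ ler_pM.
    have := ed m.+1; rewrite /R1; rewrite /seg -/(v m) in ys k1 *; lra.
  have E0' : 0 <= E * (2 * delta) by rewrite mulr_ge0 // ltW // mulr_gt0.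
  have [xR|xR] := leP `|x| R2.
    have qs y : `|y| <= R2 -> q y < 1.
      move=> yR; apply: le_lt_trans CR2; apply: le_trans (q_upper y) _.
      by rewrite ler_pM2l.
    rewrite qs //; elim: n x xR => [|m IH] x xR /=; first exact: qs.
    apply: IH; have [by0|by0] := eqVneq (b m x) 0.
      by rewrite /push by0 scale0r subr0.
    apply: le_trans (ler_normB _ _) _; rewrite R21 lerD //.
      exact: small by0.
    by rewrite normrZ ler_pM //; exact: tube_bump_bound.
  suff -> : F n x = q x by [].
  elim: n => [//|m IH]; rewrite FS //; apply/eqP; apply: contraTT xR => /small.
  by rewrite -leNgt R21 => k; apply: le_trans k _; rewrite lerDl.
Qed.
End Deletion.

Theorem theorem3p1 (R : realType) (X : completeNormedModType R)
    (p : smooth_order) (A : set X) :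
  infinite_dimensional X ->
  p <> Fin 0 ->
  starlike_body A ->
  [bounded x | x in A] ->
  smooth_body p A ->
  exists g : X -> R,
    Cp_on p setT g /\ bump_function g /\ fsupp g = A /\
    (forall x : X, interior A x -> exists h : X, fderiv g x h != 0).
Proof.
move=> infX p0 starA bA smA; set q := Defs.minkowski A in smA.
have p1 : order_le 1 p by case: p p0 {smA} => // -[].
have [C C0 q_upper] := minkowski_upper starA.
have [c c0 q_lower] := minkowski_lower starA bA.
have q_hom t x : 0 < t -> q (t *: x) = t * q x.
  exact: (minkowski_homogeneous starA).
have q0 : q 0 = 0.
  apply/eqP; rewrite eq_le; have := q_lower 0; have := q_upper 0.
  by rewrite normr0 !mulr0 => -> ->.
have q_smooth k : order_le k p -> Cnf k q [set x | x != 0].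
  move=> kp; apply: Cp_on_Cnf kp; first exact: open_neq.
  suff <- : ~` (q @^-1` [set 0]) = [set x | x != 0] by [].
  apply/seteqP; split=> x /= x0.
    by apply/eqP => x00; apply: x0; rewrite x00.
  move=> qx; have := q_lower x; rewrite -/q qx pmulr_rle0 // normr_le0.
  exact/negP.
have [F [F_smooth [F_deriv F_lt1]]] :=
  gauge_without_critical_points c0 C0 q_lower q_upper q_hom q_smooth p1 infX.
pose F' x := 1 + (-1) * F x; pose g x := flat 0 (F' x).
have g_neq0 : [set x | g x != 0] = [set x | q x < 1].
  apply/seteqP; split=> x /=; rewrite -F_lt1.
    move=> gx; rewrite ltNge; apply: contra gx => F1.
    by rewrite /g flat_le0 // /F'; lra.
  by move=> F1; rewrite gt_eqF // flat_gt0 // /F'; lra.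
have g_supp : fsupp g = A.
  by rewrite /fsupp g_neq0; exact: closure_minkowski_lt1.
exists g; split; [|split; [|split]] => //.
- by apply: Cnf_Cp_on => k kp; apply: Cnf_flat; [exact: openT|exact: F_smooth].
- split; last by rewrite g_supp.
  exists 0; have : [set x | q x < 1] 0 by rewrite /= q0.
  by rewrite -g_neq0.
- move=> x /(interior_minkowski_lt1 starA); rewrite -/q -F_lt1 => F1.
  have [L dL [u Lu]] := F_deriv x.
  have dF' : is_fderiv unit_weight (as_family F') x _ :=
    is_fderivD (is_fderiv_cst (@unit_weight_ge0 R) (fun=> 1) x)
      (is_fderivZ (-1) dL).
  have dg := is_fderiv_comp_real dF' (flat_deriv 0 (F' x)).
  (* The derivative of theta is [flat 2], positive at 1 - F because F < 1 on the interior of [A]. *)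
  exists u; rewrite (fderivE dg) oppr0 mul0r add0r add0r mulf_neq0 //.
    by rewrite gt_eqF // flat_gt0 // /F'; lra.
  by rewrite mulN1r oppr_eq0.
Qed.
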